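(* Let $0<q<1$, $v>-1$, and let $\omega:\mathbb R\to\mathbb R$ be an even function with $\omega(q^n)\neq 0$ for all $n\in\mathbb Z$. Let $\mu$ be the positive measure $d\mu(x)=\omega(x)^2|x|^{2v+1}d_qx$, where $d_qx=(1-q)\sum_{n\in\mathbb Z}q^n\delta_{q^n}$, and assume $\mu$ has finite moments of all orders. Let $(P_n)_{n\ge0}$ be the orthonormal polynomials of $\mu$. Then $(P_n)_{n\geq 0}$ is an orthonormal basis of $L^2(\mu)$ if and only if $\mu$ is determinate.
   Context: $\delta_a$ denotes the Dirac mass at $a$; the support of $\mu$ is the infinite set $\{q^n: n\in\mathbb Z\}$. The orthonormal polynomials $(P_n)$ of $\mu$ are the polynomials $P_n(x)=k_nx^n+\dots$ with $k_n>0$ and $\int P_nP_m\,d\mu=\delta_{nm}$. A positive measure $\mu$ on $\mathbb R$ with moments of all orders and infinite support is called determinate if it is the only positive measure on $\mathbb R$ with the same moments $s_n=\int x^n d\mu(x)$, $n\ge 0$; otherwise it is indeterminate. *)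

(* Defs.v *)
From HB Require Import structures.
From mathcomp Require Import all_boot all_order all_algebra.
From mathcomp Require Import all_classical all_reals all_analysis.

Set Implicit Arguments.
Unset Strict Implicit.
Unset Printing Implicit Defensive.

Import Order.TTheory GRing.Theory Num.Theory.
Import numFieldNormedType.Exports.

Local Open Scope classical_set_scope.
Local Open Scope ring_scope.

(* Discrete measure  sum_{n in Z} |c n| delta_{x n}  on the Borel sets *)
(* of R.  (Absolute value only to make it a measure for every c; in    *)
(* the theorem the weights are nonnegative anyway.)                   *)
Section dmeasure.
Context {R : realType}.
Variables (c : int -> R) (x : int -> R).

Definition dmeasure (A : set R) : \bar R :=
  (\esum_(n in [set n | A (x n)]) (`|c n|)%:E)%E.

Lemma dmeasure0 : dmeasure set0 = 0%E.
Proof. by rewrite /dmeasure (_ : [set n | set0 (x n)] = set0) ?esum_set0//; apply/seteqP; split. Qed.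

Lemma dmeasure_ge0 A : (0 <= dmeasure A)%E.
Proof. by apply: esum_ge0 => n _; rewrite lee_fin. Qed.

Lemma dmeasure_semi_sigma_additive : semi_sigma_additive dmeasure.
Proof.
move=> F mF tF mUF.
have -> : dmeasure (\bigcup_k F k) =
    (\esum_(i in \bigcup_(k in setT) [set n | F k (x n)]) (`|c i|)%:E)%E.
  by rewrite /dmeasure; congr esum; apply/seteqP; split => n /=.
rewrite esum_bigcupT; last 2 first.
- move=> i j _ _ [n [/= Hi Hj]]; apply: tF => //; by exists (x n).
- by move=> n; rewrite lee_fin.
rewrite -nneseries_esumT; last by move=> k; exact: dmeasure_ge0.
by apply: is_cvg_nneseries => k _ _; exact: dmeasure_ge0.
Qed.

HB.instance Definition _ := isMeasure.Build _ R R dmeasure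
  dmeasure0 dmeasure_ge0 dmeasure_semi_sigma_additive.

End dmeasure.

Definition qmass {R : realType} (q v : R) (om : R -> R) (n : int) : R :=
  (1 - q) * q ^ n * (om (q ^ n)) ^+ 2 * (`|q ^ n|) `^ (2 * v + 1).

Definition qmu {R : realType} (q v : R) (om : R -> R)
  : {measure set R -> \bar R} :=
  dmeasure (qmass q v om) (fun n : int => q ^ n).

Definition finite_moments {R : realType} (mu : {measure set R -> \bar R}) :=
  forall k : nat, mu.-integrable setT (fun x : R => (x ^+ k)%:E).

Definition determinate {R : realType} (mu : {measure set R -> \bar R}) :=
  forall nu : {measure set R -> \bar R},
    finite_moments nu ->
    (forall k : nat,
        (\int[nu]_x ((x ^+ k)%R)%:E = \int[mu]_x ((x ^+ k)%R)%:E)%E) ->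
    forall A : set R, measurable A -> nu A = mu A.

Definition orthonormal_polys {R : realType} (mu : {measure set R -> \bar R})
  (P : nat -> {poly R}) :=
  (forall n, size (P n) = n.+1 /\ 0 < lead_coef (P n)) /\
  (forall n m, (\int[mu]_x (((P n).[x] * (P m).[x])%R)%:E)%E = (n == m)%:R%:E).

Definition inL2 {R : realType} (mu : {measure set R -> \bar R}) (f : R -> R) :=
  measurable_fun setT f /\ (Lnorm mu 2%:E (EFin \o f) < +oo)%E.

Definition orthonormal_basis_L2 {R : realType} (mu : {measure set R -> \bar R})
  (e : nat -> R -> R) :=
  (forall n, inL2 mu (e n)) /\
  (forall n m, (\int[mu]_x ((e n x * e m x)%R)%:E)%E = (n == m)%:R%:E) /\
  (forall f, inL2 mu f -> forall eps : R, 0 < eps ->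
     exists (N : nat) (a : nat -> R),
       (Lnorm mu 2%:E (fun x => ((f x - \sum_(k < N) a k * e k x)%R)%:E) < eps%:E)%E).

(* Main.v *)
Require Import Defs.
From HB Require Import structures.
From mathcomp Require Import all_boot all_order all_algebra.
From mathcomp Require Import all_classical all_reals all_analysis.
From mathcomp Require Import measurable_realfun ring lra zify.
From mathcomp Require complex.

(* Write K_N(w) = \sum_(k < N) P_k(w)^2, the squared norm of the evaluation at w
   on the polynomials of degree < N.  Both implications rest on the fact that mu is
   determinate as soon as the K_N are not locally bounded on the real line uniformly
   in N, and conversely.

   Bounding K_N.  Suppose that Q = (X - a)^2 + b^2 and that F is a linear functional,
   bounded for the L2(mu) norm, which vanishes on the multiples of Q with F 1 != 0.
   As R[X]/Q is a field, F controls the remainders r_n of the P_n modulo Q, so these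
   are square summable.  Expanding P_n = r_n + Q h_n, the coordinates of h_n on the
   P_k are bounded by u_n u_k with u square summable, and a discrete Gronwall
   inequality gives \sum_n P_n(w)^2 < oo, locally uniformly in w.  There are two
   sources of such an F, of the form p |-> \int p/Q dsigma, where b^2/Q tends to the
   indicator of an atom a as b -> 0:
   - sigma = mu - nu, when nu has the same moments as mu but nu{a} <> mu{a};
   - sigma = g mu, when g is the residual of the projection of 1_{a} on the
     polynomials (of degree < N, with bounds uniform in N), if this residual does
     not tend to 0.

   Dense implies determinate.  In the first case density would give
   mu{w} >= 1 / (10 M) at all the atoms w = q^n, n >= 0, where M bounds K_N on
   [-1, 1]; this contradicts the finiteness of mu.  So nu and mu agree on the atoms
   of mu, hence everywhere since they have the same mass.

   Determinate implies dense.  In the second case Gauss-type quadratures having a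
   node at 0 reproduce more and more moments of mu, with a weight >= 1 / K_N(x) at
   each node x.  Hence the number of nodes in a compact set stays bounded, an
   ultrafilter limit of the quadratures is a discrete measure with the moments of
   mu, and it has positive mass at 0, whereas mu{0} = 0. *)

Set Implicit Arguments.
Unset Strict Implicit.
Unset Printing Implicit Defensive.

Import Order.TTheory GRing.Theory Num.Theory.
Import numFieldNormedType.Exports.

Local Open Scope classical_set_scope.
Local Open Scope ring_scope.

(** * Orthonormal polynomials *)

(** Lagrange's identity: the difference of the two sides is half the double sum of the squares
    [(a i * b j - a j * b i) ^+ 2]. *)
Lemma cauchy_schwarz_sum (R : realType) (I : finType) (a b : I -> R) :
  (\sum_i a i * b i) ^+ 2 <= (\sum_i a i ^+ 2) * (\sum_i b i ^+ 2).
Proof.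
have H : 0 <= \sum_i \sum_j (a i * b j - a j * b i) ^+ 2.
  by apply: sumr_ge0 => i _; apply: sumr_ge0 => j _; rewrite sqr_ge0.
have E : \sum_i \sum_j (a i * b j - a j * b i) ^+ 2 =
  2 * ((\sum_i a i ^+ 2) * (\sum_i b i ^+ 2) - (\sum_i a i * b i) ^+ 2).
  rewrite (eq_bigr (fun i => a i ^+ 2 * (\sum_j b j ^+ 2) + b i ^+ 2 * (\sum_j a j ^+ 2)
     - 2 * (a i * b i) * (\sum_j a j * b j))); last first.
    move=> i _; rewrite !mulr_sumr -big_split -sumrB /=.
    by apply: eq_bigr => j _; ring.
  by rewrite sumrB big_split /= -!mulr_suml -mulr_sumr; ring.
by move: H; rewrite E pmulr_rge0 ?ltr0n// subr_ge0.
Qed.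

Section orthonormal.
Context {R : realType}.
Variables (L : {scalar {poly R}}) (P : nat -> {poly R}).
Hypothesis sizeP : forall n, size (P n) = n.+1.
Hypothesis orthoP : forall n m, L (P n * P m) = (n == m)%:R.

(** The diagonal of the reproducing kernel of the polynomials of degree < [N]; its reciprocal is the
    classical Christoffel function. *)
Definition christoffel (N : nat) (w : R) : R := \sum_(k < N) (P k).[w] ^+ 2.

Lemma orthonormal_expansion N (p : {poly R}) : (size p <= N)%N ->
  p = \sum_(k < N) L (p * P k) *: P k.
Proof.
move=> sp.
(* Any expansion on the [P k] will do: orthonormality then identifies its coefficients. *)
suff [c pE] : exists c : nat -> R, p = \sum_(k < N) c k *: P k.
  rewrite {1}pE; apply: eq_bigr => k _; congr (_ *: _).
  rewrite pE mulr_suml linear_sum (bigD1 k)//= big1 => [|j jk].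
    by rewrite -scalerAl scalarZ orthoP eqxx mulr1 addr0.
  by rewrite -scalerAl scalarZ orthoP (inj_eq val_inj) (negbTE jk) mulr0.
elim: N p sp => [|N IH] p sp.
  by exists (fun=> 0); rewrite big_ord0; apply/eqP; rewrite -size_poly_leq0.
pose d := p`_N / (P N)`_N.
have PN0 : (P N)`_N != 0.
  by rewrite -[N in _`_N]/(N.+1.-1) -(sizeP N) -lead_coefE lead_coef_eq0 -size_poly_eq0 sizeP.
have /IH [c cE] : (size (p - d *: P N)%R <= N)%N.
  apply/leq_sizeP => j; rewrite leq_eqVlt => /predU1P[<-|Nj].
    by rewrite coefB coefZ /d divfK// subrr.
  rewrite coefB coefZ [p`_j]nth_default ?(leq_trans sp)// [(P N)`_j]nth_default ?sizeP//.
  by rewrite mulr0 subr0.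
exists (fun k => if (k < N)%N then c k else d).
rewrite big_ord_recr /= ltnn (eq_bigr (fun k : 'I_N => c k *: P k)) => [|k _].
  by rewrite -cE subrK.
by rewrite ltn_ord.
Qed.

Lemma orthonormal_orth n (p : {poly R}) : (size p <= n)%N -> L (p * P n) = 0.
Proof.
move=> sp; rewrite (orthonormal_expansion sp) mulr_suml linear_sum big1// => k _.
by rewrite -scalerAl scalarZ orthoP ltn_eqF// mulr0.
Qed.

Lemma parseval N (p r : {poly R}) : (size p <= N)%N ->
  L (p * r) = \sum_(k < N) L (p * P k) * L (r * P k).
Proof.
move=> sp; rewrite {1}(orthonormal_expansion sp) mulr_suml linear_sum.
by apply: eq_bigr => k _; rewrite -scalerAl scalarZ [P k * r]mulrC.
Qed.

(** Cauchy-Schwarz on the orthonormal expansion of [p]. *)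
Lemma sqr_horner_le N (p : {poly R}) w : (size p <= N)%N ->
  p.[w] ^+ 2 <= christoffel N w * L (p * p).
Proof.
move=> sp; rewrite {1}(orthonormal_expansion sp) horner_sum mulrC.
rewrite (parseval p sp) (eq_bigr (fun k : 'I_N => L (p * P k) * (P k).[w])); last first.
  by move=> k _; rewrite hornerZ.
exact: cauchy_schwarz_sum.
Qed.

Lemma orthonormal_sqr_ge0 (p : {poly R}) : 0 <= L (p * p).
Proof.
by rewrite (parseval p (leqnn _)); apply: sumr_ge0 => k _; rewrite -expr2 sqr_ge0.
Qed.

Lemma orthonormal_sqr_eq0 (p : {poly R}) : L (p * p) = 0 -> p = 0.
Proof.
rewrite (parseval p (leqnn _)) => /eqP.
rewrite psumr_eq0 => [|k _]; last by rewrite -expr2 sqr_ge0.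
move=> /allP H; rewrite (orthonormal_expansion (leqnn (size p))) big1// => k _.
have := H k; rewrite mem_index_enum => /(_ isT) /=.
by rewrite mulf_eq0 orbb => /eqP ->; rewrite scale0r.
Qed.

End orthonormal.

(** * Bounds on the evaluation functionals *)

(** The sums [S n = 1 + \sum_(k < n) u k * |x k|] grow at each step by a factor at most
    [1 + D * u n ^+ 2], so they stay below [expR (D * U)]; then [|x n|] is at most
    [D * expR (D * U) * u n]. *)
Lemma discrete_gronwall (R : realType) (x u : nat -> R) (D U : R) (N : nat) :
  0 <= D -> (forall n, 0 <= u n) ->
  (forall n, (n < N)%N -> `|x n| <= D * u n * (1 + \sum_(k < n) u k * `|x k|)) ->
  \sum_(n < N) u n ^+ 2 <= U ->
  \sum_(n < N) x n ^+ 2 <= D ^+ 2 * U * expR (D * U) ^+ 2.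
Proof.
move=> D0 u0 xu uU; pose S n := 1 + \sum_(k < n) u k * `|x k|.
have S0 n : 0 <= S n.
  by rewrite addr_ge0// sumr_ge0// => k _; rewrite mulr_ge0.
have SE n : (n <= N)%N -> S n <= expR (D * \sum_(k < n) u k ^+ 2).
  elim: n => [|n IH] nN; first by rewrite /S !big_ord0 mulr0 expR0 addr0.
  rewrite /S !big_ord_recr /= addrA -/(S n) mulrDr expRD.
  apply: (@le_trans _ _ (S n * (1 + D * u n ^+ 2))).
    rewrite mulrDr mulr1 lerD2l; apply: le_trans (ler_wpM2l (u0 n) (xu _ nN)) _.
    by rewrite -/(S n) le_eqVlt; apply/orP; left; apply/eqP; ring.
  by apply: ler_pM => //; [rewrite addr_ge0// mulr_ge0// sqr_ge0|exact/IH/ltnW|exact: expR_ge1Dx].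
have SU n : (n < N)%N -> S n <= expR (D * U).
  move=> nN; apply: le_trans (SE _ (ltnW nN)) _; rewrite ler_expR ler_wpM2l//.
  apply: le_trans uU; rewrite -(subnKC (ltnW nN)) big_split_ord /= lerDl.
  by apply: sumr_ge0 => k _; rewrite sqr_ge0.
apply: (@le_trans _ _ (\sum_(n < N) D ^+ 2 * expR (D * U) ^+ 2 * u n ^+ 2)).
  apply: ler_sum => n _; rewrite -(real_normK (num_real (x n))).
  rewrite -!exprMn ler_pXn2r ?nnegrE ?mulr_ge0 ?expR_ge0//.
  apply: le_trans (xu _ (ltn_ord n)) _.
  rewrite -/(S n) [leRHS]mulrAC; apply: ler_wpM2l; first by rewrite mulr_ge0.
  exact: SU.
rewrite -mulr_sumr [leRHS]mulrAC; apply: ler_wpM2l => //.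
by rewrite mulr_ge0// sqr_ge0.
Qed.

Definition quadratic (R : realType) (a b : R) : {poly R} :=
  ('X - a%:P) ^+ 2 + (b ^+ 2)%:P.

Lemma horner_quadratic (R : realType) (a b x : R) :
  (quadratic a b).[x] = (x - a) ^+ 2 + b ^+ 2.
Proof. by rewrite /quadratic !hornerE. Qed.

Lemma size_quadratic (R : realType) (a b : R) : size (quadratic a b) = 3%N.
Proof.
rewrite /quadratic size_polyDl size_exp_XsubC//.
by rewrite (leq_ltn_trans (size_polyC_leq1 _)).
Qed.

Lemma size2_XsubC (R : realType) (r : {poly R}) (a : R) : (size r <= 2)%N ->
  r = (r.[a])%:P + r`_1 *: ('X - a%:P).
Proof.
move=> sr; apply/polyP => -[|[|i]]; rewrite coefD coefZ coefC coefB coefX coefC /=.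
- rewrite (horner_coef_wide _ sr) big_ord_recl big_ord1 /= expr0 mulr1 expr1; ring.
- by rewrite subr0 mulr1 add0r.
- by rewrite subr0 mulr0 addr0 nth_default // (leq_trans sr).
Qed.

Section evaluation_bound.
Context {R : realType}.
Variables (L : {scalar {poly R}}) (P : nat -> {poly R}).
Hypothesis sizeP : forall n, size (P n) = n.+1.
Hypothesis orthoP : forall n m, L (P n * P m) = (n == m)%:R.

(** [M] is chosen before [T], [F] and [N], hence the uniformity. [T] stands for [p |-> L (p / Q)]
    and expresses the coordinates of the quotient of [P n] by [Q], while [F], nonzero at 1 and zero
    on low multiples of [Q], controls the remainders. *)
Lemma christoffel_bounded (a b c C A : R) : 0 < b -> 0 < c -> 0 <= A ->
  exists M : R, forall (T F : {scalar {poly R}}) (N : nat),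
    (forall p, T (quadratic a b * p) = L p) ->
    (forall p : {poly R}, (size p <= N)%N -> F (quadratic a b * p) = 0) ->
    \sum_(n < N) T (P n) ^+ 2 <= C ->
    \sum_(n < N) T (('X - a%:P) * P n) ^+ 2 <= C ->
    \sum_(n < N) F (P n) ^+ 2 <= C ->
    \sum_(n < N) F (('X - a%:P) * P n) ^+ 2 <= C ->
    c <= `|F 1| ->
    forall w, `|w| <= A -> christoffel P N w <= M.
Proof.
move=> b0 c0 A0.
(* [C1] will bound the sum of [al n ^+ 2 + b ^+ 2 * be n ^+ 2], [U] that of [u n ^+ 2], and [D]
   collects the coefficients of the recursion for [|w| <= A]. *)
pose C1 := (b ^+ 2 * C + C) / (b ^+ 2 * c ^+ 2).
pose U := 4 * (C1 + C1 / b ^+ 2 + C + C).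
pose D := 1 + A + `|a| + 2 * ((A + `|a|) ^+ 2 + b ^+ 2).
exists (D ^+ 2 * U * expR (D * U) ^+ 2) => T F N TL F0 TC TYC FC FYC cF w wA.
set Q := quadratic a b in TL F0 *; set Y := 'X - a%:P in TYC FYC *.
have D0 : 0 <= D.
  by rewrite addr_ge0 ?addr_ge0// mulr_ge0// addr_ge0 ?sqr_ge0.
have Q0 : Q != 0 by rewrite -size_poly_eq0 size_quadratic.
have YY : Y * Y = Q - (b ^+ 2)%:P by rewrite /Q /quadratic -/Y addrK expr2.
pose h n := P n %/ Q; pose r n := P n %% Q.
pose be n := (r n)`_1; pose al n := (r n).[a].
have hr n : P n = Q * h n + r n by rewrite mulrC; exact: divp_eq.
have rE n : r n = (al n)%:P + be n *: Y.
  by apply: size2_XsubC; rewrite -ltnS -(size_quadratic a b) ltn_modp.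
have sh n : (size (h n) <= n.-1)%N by rewrite size_divp// sizeP size_quadratic subn2.
have hP n k : L (h n * P k) = T (P n * P k) - al n * T (P k) - be n * T (Y * P k).
  rewrite -TL mulrA; have -> : Q * h n = P n - r n by rewrite [in P n]hr addrK.
  rewrite mulrBl linearB /= rE mulrDl linearD /= mul_polyC scalarZ -scalerAl scalarZ.
  by rewrite opprD addrA.
(* The quotient [h k] has degree < [n], so it is orthogonal to [P n]. This splits [T (P n * P k)]
   into products of a factor in [k] and a factor in [n], the form that Gronwall's inequality
   requires. *)
have TPP n k : (k <= n)%N -> T (P n * P k) = al k * T (P n) + be k * T (Y * P n).
  move=> kn; have : L (h k * P n) = 0.
    by apply: (orthonormal_orth sizeP orthoP); apply: leq_trans (sh k) _; rewrite (leq_trans (leq_pred _)).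
  by rewrite hP [P k * P n]mulrC; lra.
pose u n := `|al n| + `|be n| + `|T (P n)| + `|T (Y * P n)|.
have u0 n : 0 <= u n by rewrite !addr_ge0.
have aleu n : `|al n| + `|be n| <= u n by rewrite /u -addrA lerDl addr_ge0.
have teu n : `|T (P n)| + `|T (Y * P n)| <= u n by rewrite /u -addrA lerDr addr_ge0.
have cross (x1 x2 y1 y2 : R) : `|x1 * y1 + x2 * y2| <= (`|x1| + `|x2|) * (`|y1| + `|y2|).
  apply: le_trans (ler_normD _ _) _; rewrite !normrM.
  have := normr_ge0 x1; have := normr_ge0 x2; have := normr_ge0 y1; have := normr_ge0 y2.
  by nra.
have bnk n k : (k < n)%N -> `|L (h n * P k)| <= 2 * (u n * u k).
  move=> kn; rewrite hP (TPP _ _ (ltnW kn)).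
  have -> : al k * T (P n) + be k * T (Y * P n) - al n * T (P k) - be n * T (Y * P k)
    = (al k * T (P n) + be k * T (Y * P n)) - (al n * T (P k) + be n * T (Y * P k)) by ring.
  apply: le_trans (ler_normB _ _) _.
  have -> : 2 * (u n * u k) = u k * u n + u n * u k by ring.
  by apply: lerD; apply: le_trans (cross _ _ _ _) _; apply: ler_pM; rewrite ?addr_ge0.
have wa : `|w - a| <= A + `|a| by apply: le_trans (ler_normB _ _) _; rewrite lerD2r.
have Qw : `|Q.[w]| <= (A + `|a|) ^+ 2 + b ^+ 2.
  rewrite horner_quadratic ger0_norm ?addr_ge0 ?sqr_ge0// lerD2r.
  by rewrite -[leLHS]ger0_norm ?sqr_ge0// normrX ler_pXn2r ?nnegrE ?addr_ge0.
apply: (@discrete_gronwall _ (fun n => (P n).[w]) u) => //.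
- move=> n nN; have nhE := orthonormal_expansion sizeP orthoP (leq_trans (sh n) (leq_pred n)).
  have rw : (r n).[w] = al n + be n * (w - a) by rewrite rE /Y !hornerE.
  rewrite {1}hr (hornerD (Q * h n)) (hornerM Q) {1}nhE horner_sum rw.
  apply: le_trans (ler_normD _ _) _.
  have Ha : `|al n + be n * (w - a)| <= u n * (1 + A + `|a|).
    rewrite -[al n]mulr1; apply: le_trans (cross _ _ _ _) _.
    rewrite normr1 -addrA; apply: ler_pM; rewrite ?addr_ge0//.
    by rewrite lerD2l.
  have Hs : `|Q.[w] * \sum_(i < n) (L (h n * P i) *: P i).[w]| <=
    ((A + `|a|) ^+ 2 + b ^+ 2) * (2 * u n * \sum_(k < n) u k * `|(P k).[w]|).
    rewrite normrM; apply: ler_pM => //.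
    apply: le_trans (ler_norm_sum _ _ _) _; rewrite mulr_sumr; apply: ler_sum => k _.
    rewrite hornerZ normrM mulrA; apply: ler_wpM2r => //.
    by rewrite -mulrA; exact: bnk.
  apply: le_trans (lerD Hs Ha) _.
  set S := \sum_(k < n) _.
  have S0 : 0 <= S by apply: sumr_ge0 => k _; rewrite mulr_ge0.
  set B := (A + `|a|) ^+ 2 + b ^+ 2; have B0 : 0 <= B by rewrite /B addr_ge0 ?sqr_ge0.
  have -> : D = 1 + A + `|a| + 2 * B by [].
  have := mulr_ge0 (u0 n) S0; have := mulr_ge0 (u0 n) B0.
  set Z := 1 + A + `|a|; have Z0 : 0 <= Z by rewrite !addr_ge0.
  move=> p1 p2; have := mulr_ge0 p2 Z0; nra.
- rewrite /U.
  have le4 n : u n ^+ 2 <= 4 * (al n ^+ 2 + be n ^+ 2 + T (P n) ^+ 2 + T (Y * P n) ^+ 2).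
    rewrite /u; move: (al n) (be n) (T _) (T _) => x y z t.
    rewrite -(real_normK (num_real x)) -(real_normK (num_real y)).
    rewrite -(real_normK (num_real z)) -(real_normK (num_real t)).
    move: `|x| `|y| `|z| `|t| => {}x {}y {}z {}t.
    have := sqr_ge0 (x - y); have := sqr_ge0 (x - z); have := sqr_ge0 (x - t).
    have := sqr_ge0 (y - z); have := sqr_ge0 (y - t); have := sqr_ge0 (z - t).
    by rewrite !expr2; lra.
  apply: le_trans (ler_sum _ (fun (n : 'I_N) _ => le4 n)) _.
  rewrite -mulr_sumr; apply: ler_wpM2l => //; rewrite !big_split /=.
  have b20 : 0 < b ^+ 2 by rewrite exprn_gt0.
  have c20 : 0 < c ^+ 2 by rewrite exprn_gt0.
  have key (n : nat) : (n < N)%N ->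
      (al n ^+ 2 + b ^+ 2 * be n ^+ 2) * (b ^+ 2 * c ^+ 2) <=
      b ^+ 2 * F (P n) ^+ 2 + F (Y * P n) ^+ 2.
    move=> nN.
    have FQ (p : {poly R}) : (size p <= n.+1)%N -> F (Q * p) = 0.
      by move=> sp; apply: F0; rewrite (leq_trans sp).
    (* [F] sees only remainders modulo [Q], where [Y * Y] acts as [- b ^+ 2]; the result is a linear
       system in [al n] and [be n] with coefficients built from [F 1] and [F Y]. *)
    have E1 : F (P n) = al n * F 1 + be n * F Y.
      rewrite hr linearD /= FQ ?add0r; last by rewrite (leq_trans (sh n))// (leq_trans (leq_pred n)).
      by rewrite rE linearD /= -alg_polyC !scalarZ.
    have FQ1 : F Q = 0 by rewrite -[Q]mulr1 FQ ?size_poly1.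
    have E2 : F (Y * P n) = al n * F Y - b ^+ 2 * be n * F 1.
      rewrite hr mulrDr mulrCA linearD /= FQ ?add0r; last first.
        rewrite (leq_trans (size_polyMleq _ _))// size_XsubC /=.
        by rewrite ltnS (leq_trans (sh n))// leq_pred.
      rewrite rE mulrDr linearD /= -scalerAr [Y * _%:P]mulrC mul_polyC !scalarZ YY.
      rewrite [F (Q - _)]linearB /= FQ1 -[(b ^+ 2)%:P]alg_polyC scalarZ sub0r.
      by ring.
    (* Multiplicativity of the norm of R[X]/Q, identified with the complex numbers. *)
    have -> : b ^+ 2 * F (P n) ^+ 2 + F (Y * P n) ^+ 2 =
      (al n ^+ 2 + b ^+ 2 * be n ^+ 2) * (b ^+ 2 * F 1 ^+ 2 + F Y ^+ 2).
      by rewrite E1 E2; ring.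
    apply: ler_wpM2l; first by rewrite addr_ge0 ?sqr_ge0// mulr_ge0 ?sqr_ge0.
    have : c ^+ 2 <= F 1 ^+ 2.
      by rewrite -(real_normK (num_real (F 1))) ler_pXn2r ?nnegrE// ltW.
    by move=> cF1; rewrite ler_wpDr ?sqr_ge0// ler_wpM2l// ltW.
  have Sab : (\sum_(n < N) al n ^+ 2 + b ^+ 2 * \sum_(n < N) be n ^+ 2) <= C1.
    rewrite /C1 ler_pdivlMr ?mulr_gt0// mulr_sumr -big_split mulr_suml /=.
    apply: le_trans (ler_sum _ (fun (n : 'I_N) _ => key n (ltn_ord n))) _.
    rewrite big_split /= -mulr_sumr; apply: lerD => //.
    by apply: ler_wpM2l => //; exact: ltW.
  have Sal : 0 <= \sum_(n < N) al n ^+ 2 by apply: sumr_ge0 => n _; rewrite sqr_ge0.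
  have Sbe : 0 <= \sum_(n < N) be n ^+ 2 by apply: sumr_ge0 => n _; rewrite sqr_ge0.
  apply: lerD => //; apply: lerD => //; apply: lerD.
    by apply: le_trans Sab; rewrite lerDl mulr_ge0 // ltW.
  by rewrite ler_pdivlMr// mulrC; apply: le_trans Sab; rewrite lerDr.
Qed.

End evaluation_bound.

(** * Quadratures *)

Section real_split.
Import complex.
Local Open Scope complex_scope.

(** Induction on the degree through a complex root [a + i b]. A real root is divided out; if
    [b != 0], the remainder modulo [quadratic a b] is real, affine and zero at [a + i b], hence
    zero, against the hypothesis. *)
Lemma real_poly_split (R : realType) (p : {poly R}) : p != 0 ->
  (forall a b, b != 0 -> ~~ (quadratic a b %| p)) ->
  exists s : seq R, p = lead_coef p *: \prod_(x <- s) ('X - x%:P).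
Proof.
have [n] := ubnP (size p); elim: n p => // n IH p; rewrite ltnS => spn p0 pQ.
have [sp1|sp1] := eqVneq (size p) 1%N.
  exists [::]; rewrite big_nil; apply/polyP => i.
  by rewrite {1}(size1_polyC (eq_leq sp1)) lead_coefE sp1 alg_polyC.
have /closed_rootP[[a b] rz] : size (map_poly (real_complex R) p) != 1%N.
  by rewrite size_map_poly.
have [b0|b0] := eqVneq b 0.
  move: rz; rewrite b0 -[a +i* 0]/(real_complex R a) fmorph_root => /factor_theorem[u uE].
  have u0 : u != 0 by apply: contraNneq p0 => u0; rewrite uE u0 mul0r.
  have [|//||s us] := IH u.
  - by rewrite (leq_trans _ spn)// uE size_Mmonic ?monicXsubC// size_XsubC addn2.
  - by move=> c d d0; apply: contra (pQ c d d0) => ?; rewrite uE dvdp_mulr.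
  - exists (a :: s); rewrite big_cons {1}uE {1}us.
    by rewrite uE lead_coef_Mmonic ?monicXsubC// -scalerAl mulrC.
have /negP[] := pQ a b b0.
set Q := quadratic a b; apply/modp_eq0P.
have Q0 : Q != 0 by rewrite -size_poly_eq0 size_quadratic.
pose r := p %% Q; pose be := r`_1; pose al := r.[a].
have rE : r = al%:P + be *: ('X - a%:P).
  by apply: size2_XsubC; rewrite -ltnS -(size_quadratic a b) ltn_modp.
move: rz; rewrite {1}(divp_eq p Q) -/r /root rmorphD rmorphM /= hornerD hornerM.
have -> : (map_poly (real_complex R) Q).[a +i* b] = 0.
  rewrite /Q /quadratic rmorphD rmorphXn rmorphB /= map_polyX !map_polyC /= !hornerE /=.
  by apply/eqP; rewrite eq_complex /=; apply/andP; split; apply/eqP; ring.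
rewrite mulr0 add0r rE rmorphD /= map_polyZ rmorphB /= map_polyX !map_polyC /= !hornerE /=.
rewrite eq_complex /= => /andP[/eqP h1 /eqP h2].
have be0 : be = 0.
  have : be * b = 0 by rewrite -[RHS]h2; ring.
  by move/eqP; rewrite mulf_eq0 (negbTE b0) orbF => /eqP.
have al0 : al = 0 by rewrite -[RHS]h1 be0; ring.
by rewrite al0 be0 scale0r polyC0 addr0.
Qed.

End real_split.

Lemma not_uniq_perm (T : eqType) (s : seq T) : ~~ uniq s ->
  exists x s', perm_eq s [:: x, x & s'].
Proof.
elim: s => // y s IH /=; rewrite negb_and negbK => /orP[ys|/IH[x [s' ss']]].
  by exists y, (rem y s); rewrite perm_cons perm_to_rem.
exists x, (y :: s'); rewrite -[[:: x, x, y & s']]/([:: x; x] ++ [:: y] ++ s').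
by rewrite perm_sym perm_catCA /= perm_cons perm_sym.
Qed.

Section quadrature.
Context {R : realType}.
Variables (L : {scalar {poly R}}) (P : nat -> {poly R}).
Hypothesis sizeP : forall n, size (P n) = n.+1.
Hypothesis orthoP : forall n m, L (P n * P m) = (n == m)%:R.

(** A combination of [P n.+1] and [P n] stays orthogonal to degrees < [n], and one parameter
    suffices to make it vanish at [w]. Its roots will be the nodes of a quadrature of Gauss-Radau
    type with prescribed node [w]. *)
Lemma quasi_orthogonal n w : exists pi : {poly R},
  [/\ (n < size pi <= n.+2)%N, root pi w &
      forall p : {poly R}, (size p <= n)%N -> L (pi * p) = 0].
Proof.
have orth m (p : {poly R}) : (size p <= n)%N -> (n <= m)%N -> L (P m * p) = 0.
  by move=> sp nm; rewrite mulrC (orthonormal_orth sizeP orthoP)// (leq_trans sp).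
have [w0|w0] := boolP (root (P n) w).
  by exists (P n); split=> //; [rewrite sizeP ltnS leqnn leqnSn|move=> p sp; exact: orth].
pose c := (P n.+1).[w] / (P n).[w].
exists (P n.+1 - c *: P n); split.
- rewrite size_polyDl ?sizeP ?leqnn ?andbT ?leqnSn//.
  by rewrite size_polyN (leq_ltn_trans (size_scale_leq _ _))// sizeP.
- by rewrite /root !hornerE /c divfK// subrr.
- by move=> p sp; rewrite mulrBl linearB /= -scalerAl scalarZ !orth// mulr0 subrr.
Qed.

(** If [pi = u * quadratic a b], then [L (pi * u)] is the squared norm of [(X - a) u] plus [b ^+ 2]
    times that of [u], which is positive, whereas the degree of [u] makes it zero. A double root [x]
    is excluded in the same way with [pi = (X - x) ^+ 2 * u]. *)
Lemma quasi_orthogonal_split n (pi : {poly R}) : (n < size pi <= n.+2)%N ->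
  (forall p : {poly R}, (size p <= n)%N -> L (pi * p) = 0) ->
  exists2 s, uniq s & pi = lead_coef pi *: \prod_(x <- s) ('X - x%:P).
Proof.
move=> /andP[npi pin] pi_orth.
have pi0 : pi != 0 by rewrite -size_poly_gt0 (leq_ltn_trans _ npi).
have L0 := orthonormal_sqr_ge0 sizeP orthoP.
have Leq0 := orthonormal_sqr_eq0 sizeP orthoP.
have [|s piE] := real_poly_split pi0.
  move=> a b b0; apply/negP => /dvdpP[u uE].
  have u0 : u != 0 by apply: contraNneq pi0 => u0; rewrite uE u0 mul0r.
  have su : (size u <= n)%N.
    move: pin; rewrite uE size_mul// ?size_quadratic -?size_poly_eq0 ?size_quadratic//.
    by rewrite addn3 /= !ltnS.
  have : L (pi * u) = L (('X - a%:P) * u * (('X - a%:P) * u)) + b ^+ 2 * L (u * u).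
    rewrite uE -scalarZ -linearD /=; congr (L _).
    by rewrite /quadratic -mul_polyC; ring.
  have h := mulr_ge0 (sqr_ge0 b) (L0 u).
  rewrite pi_orth// => /esym/eqP; rewrite paddr_eq0//.
  by rewrite mulf_eq0 expf_eq0 (negbTE b0) /= => /andP[_ /eqP/Leq0/eqP]; apply/negP.
exists s => //; apply/negPn/negP => /not_uniq_perm[x [s' ss']].
move: piE; rewrite (perm_big _ ss') /= !big_cons => piE.
pose u := lead_coef pi *: \prod_(j <- s') ('X - j%:P).
have {}piE : pi = ('X - x%:P) * (('X - x%:P) * u).
  by rewrite {1}piE /u -!scalerAr.
have u0 : u != 0 by apply: contraNneq pi0 => u0; rewrite piE u0 !mulr0.
have su : (size u <= n)%N.
  by move: pin; rewrite piE !(size_monicM, monicXsubC, size_XsubC)//= ?mulf_neq0 ?polyXsubC_eq0.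
have /Leq0/eqP : L (('X - x%:P) * u * (('X - x%:P) * u)) = 0.
  by rewrite -[RHS](pi_orth u su) piE; congr (L _); ring.
by rewrite mulf_eq0 polyXsubC_eq0 (negbTE u0).
Qed.

(** Lagrange interpolation at the roots of [pi], with weights [L (l x)]. As [l x * (l x - 1)] is
    [pi] times a polynomial of degree < [n], [L (l x) = L (l x * l x)]; the evaluation bound for
    [l x], which is 1 at [x], then gives the lower bound on the weight. *)
Lemma quadrature N w : (0 < N)%N -> exists (s : seq R) (l : R -> R),
  [/\ uniq s, w \in s, forall x, x \in s -> 1 <= christoffel P N x * l x &
      forall p : {poly R}, (size p < N)%N -> L p = \sum_(x <- s) l x * p.[x]].
Proof.
case: N => // n _.
have [pi [szpi piw pi_orth]] := quasi_orthogonal n w.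
have [s us piE] := quasi_orthogonal_split szpi pi_orth.
have pi0 : pi != 0 by case/andP: szpi => h _; rewrite -size_poly_gt0 (leq_ltn_trans _ h).
have lc0 : lead_coef pi != 0 by rewrite lead_coef_eq0.
have szs : size pi = (size s).+1 by rewrite piE size_scale// size_prod_XsubC.
pose D x := \prod_(y <- rem x s) ('X - y%:P).
have DE x : x \in s -> pi = lead_coef pi *: (('X - x%:P) * D x).
  by move=> xs; rewrite {1}piE (perm_big _ (perm_to_rem xs)) big_cons.
have Dx x : x \in s -> (D x).[x] != 0.
  by move=> xs; rewrite -[_ == 0]/(root _ _) root_prod_XsubC mem_rem_uniq// inE eqxx.
pose l x := ((D x).[x])^-1 *: D x.
have lx x : x \in s -> (l x).[x] = 1 by move=> xs; rewrite /l hornerZ mulVf// Dx.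
have ly x y : y \in s -> y != x -> (l x).[y] = 0.
  move=> ys yx; rewrite /l hornerZ (_ : (D x).[y] = 0) ?mulr0//; apply/eqP.
  by rewrite -[_ == 0]/(root _ _) root_prod_XsubC mem_rem_uniq// inE yx.
have szl x : x \in s -> size (l x) = size s.
  move=> xs; rewrite /l size_scale ?invr_eq0 ?Dx// size_prod_XsubC size_rem//.
  by rewrite prednK//; case: (s) xs.
(* There are [N - 1] or [N] nodes: enough to interpolate [p] with [size p < N], and few enough for
   the kernel of order [N] to apply to [l x]. *)
have sn : (n <= size s <= n.+1)%N by rewrite -ltnS -[(size s <= _)%N]ltnS -szs.
have Ll x : x \in s -> L (l x * l x) = L (l x).
  move=> xs; have /factor_theorem[v vE] : root (l x - 1) x.
    by rewrite /root hornerD hornerN hornerC lx// subrr.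
  have sv : (size v <= n)%N.
    have [->|v0] := eqVneq v 0; first by rewrite size_poly0.
    have : (size (l x - 1)%R <= n.+1)%N.
      rewrite (leq_trans (size_polyD _ _))// geq_max size_polyN size_poly1 szl//.
      by case/andP: sn => _ ->.
    by rewrite vE size_Mmonic ?monicXsubC// size_XsubC addn2.
  apply/eqP; rewrite -subr_eq0 -linearB /= -[X in _ - X]mulr1 -mulrBr vE.
  have -> : l x * (v * ('X - x%:P)) = ((D x).[x] * lead_coef pi)^-1 *: (pi * v).
    rewrite {2}(DE x xs) /l -!scalerAl scalerA invfM mulrVK ?unitfE//.
    by congr (_ *: _); ring.
  by rewrite scalarZ pi_orth// mulr0.
exists s, (fun x => L (l x)); split => //.
- by move: piw; rewrite piE rootZ// root_prod_XsubC.
- move=> x xs; rewrite -Ll//; apply: le_trans (sqr_horner_le sizeP orthoP x _).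
    by rewrite lx// expr1n.
  by rewrite szl//; case/andP: sn.
- move=> p sp.
  suff pE : p = \sum_(x <- s) p.[x] *: l x.
    by rewrite {1}pE linear_sum; apply: eq_bigr => x _; rewrite scalarZ mulrC.
  apply/eqP; rewrite -subr_eq0; apply/eqP.
  apply: (@roots_geq_poly_eq0 _ _ s) => //.
    apply/allP => y ys; rewrite /root hornerD hornerN horner_sum (bigD1_seq y)//=.
    rewrite hornerZ lx// big1_seq ?addr0 ?mulr1 ?subrr// => x /andP[xy xs].
    by rewrite hornerZ ly ?mulr0// eq_sym.
  rewrite (leq_trans (size_polyD _ _))// geq_max; apply/andP; split.
    by case/andP: sn => h _; rewrite (leq_trans _ h).
  rewrite size_polyN big_seq; elim/big_ind: _ => [|q1 q2 h1 h2|x xs].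
  - by rewrite size_poly0.
  - by rewrite (leq_trans (size_polyD _ _))// geq_max h1.
  - by rewrite (leq_trans (size_scale_leq _ _))// szl.
Qed.

End quadrature.

Lemma real_cvg_unique (R : realType) (T : topologicalType) (F : set_system T)
  (f : T -> R) (l l' : R) : ProperFilter F -> f @ F --> l -> f @ F --> l' -> l = l'.
Proof.
move=> FF fl fl'; have lef : \forall x \near F, f x <= f x by near=> x.
by apply/le_anti; rewrite (ler_cvg_to fl fl' lef) (ler_cvg_to fl' fl lef).
Unshelve. all: by end_near.
Qed.

(** * Limits of quadratures along an ultrafilter *)

Section limit_of_quadratures.
Context {R : realType}.
Variables (L : {scalar {poly R}}) (P : nat -> {poly R}).
Hypothesis sizeP : forall n, size (P n) = n.+1.
Hypothesis orthoP : forall n m, L (P n * P m) = (n == m)%:R.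

(** Sorting by absolute value puts the node 0 first and makes the nodes of [[-A, A]] an initial
    segment. Zero weights from index [m] on allow sums of any larger length, so that rules of
    different sizes can be compared index by index. *)
Lemma sorted_quadrature N : (0 < N)%N -> exists (l y : nat -> R) (m : nat),
  [/\ y 0%N = 0 /\ (0 < m)%N,
      forall i, 0 <= l i /\ ((m <= i)%N -> l i = 0),
      forall i, (i < m)%N -> 1 <= christoffel P N (y i) * l i,
      forall i j, (i <= j < m)%N -> `|y i| <= `|y j| &
      forall n (p : {poly R}), (m <= n)%N -> (size p < N)%N ->
        L p = \sum_(i < n) l i * p.[y i]].
Proof.
move=> /(quadrature sizeP orthoP 0)[s [l [us s0 sl sL]]].
pose e := fun x x' : R => `|x| <= `|x'|.
have etot : total e by move=> x x'; exact: le_total.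
have etr : transitive e by move=> x x' x''; exact: le_trans.
pose t := sort e s.
have ts x : (x \in t) = (x \in s) by rewrite mem_sort.
have tsrt : sorted e t by exact: sort_sorted.
have t0 : (0 < size t)%N by rewrite size_sort; case: (s) s0.
have mono i j : (i <= j < size t)%N -> `|t`_i| <= `|t`_j|.
  move=> /andP[ij jt]; apply: (@sorted_leq_nth _ e etr _ 0 t tsrt) => //.
    by move=> x; rewrite /e.
  by rewrite inE (leq_ltn_trans ij).
exists (fun i => if (i < size t)%N then l t`_i else 0), (nth 0 t), (size t); split=> //.
- split=> //; have := s0; rewrite -ts => /(nthP 0)[i it ti].
  by have := mono 0%N i it; rewrite ti normr0 normr_le0 => /eqP.
- move=> i; split; last by rewrite ltnNge => ->.
  case: ifP => // it.
  have := sl t`_i; rewrite -ts mem_nth// => /(_ isT) h.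
  have c0 : 0 <= christoffel P N t`_i by apply: sumr_ge0 => k _; rewrite sqr_ge0.
  by rewrite leNgt; apply/negP => l0; nra.
- by move=> i it; rewrite it; apply: sl; rewrite -ts mem_nth.
- move=> n p tn sp; rewrite sL// -(perm_big _ (permEl (perm_sort e s))) /= -/t.
  rewrite (big_nth 0) -(subnKC tn) big_split_ord /= [X in _ = _ + X]big1 ?addr0; last first.
    by move=> i _; rewrite ltnNge leq_addr mul0r.
  by rewrite big_mkord; apply: eq_bigr => i _; rewrite ltn_ord.
Qed.

(** An ultrafilter converges to each of its cluster points, and compactness of a segment provides
    one. *)
Lemma ultralimit (U : set_system nat) (u : nat -> R) (B : R) : UltraFilter U ->
  (\forall n \near U, `|u n| <= B) -> exists l : R, u @ U --> l.
Proof.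
move=> UU uB.
have uU : (u @ U) `[- B, B]%classic by apply: filterS uB => n; rewrite /= in_itv /= ler_norml.
have [l [_ ul]] := @segment_compact R (- B) B (u @ U) _ uU.
exists l => V Vl; have [//|UV] := in_ultra_setVsetC (u @^-1` V) UU.
by have [x [Vx nVx]] := ul (~` V) V UV Vl.
Qed.

(** The limits are those of the products [l i * y i ^+ k], index by index, since a node may escape
    to infinity while its weight vanishes. The bound [M 0] keeps the weight of the node 0 away from
    zero. *)
Lemma moments_of_bounded_christoffel (M : R -> R) :
  (forall A N w, `|w| <= A -> christoffel P N w <= M A) ->
  exists l y : nat -> R, [/\ forall i, 0 <= l i, 0 < l 0%N, y 0%N = 0 &
    forall k, (fun n : nat => \sum_(i < n) l i * y i ^+ k) @ \oo --> L 'X^k].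
Proof.
move=> PM; pose good N (f : (nat -> R) * (nat -> R) * nat) :=
  [/\ f.1.2 0%N = 0 /\ (0 < f.2)%N,
      forall i, 0 <= f.1.1 i /\ ((f.2 <= i)%N -> f.1.1 i = 0),
      forall i, (i < f.2)%N -> 1 <= christoffel P N.+1 (f.1.2 i) * f.1.1 i,
      forall i j, (i <= j < f.2)%N -> `|f.1.2 i| <= `|f.1.2 j| &
      forall n (p : {poly R}), (f.2 <= n)%N -> (size p < N.+1)%N ->
        L p = \sum_(i < n) f.1.1 i * p.[f.1.2 i]].
have /choice[f fgood] : forall N, exists f, good N f.
  by move=> N; have [l [y [m H]]] := @sorted_quadrature N.+1 isT; exists (l, y, m).
pose l N := (f N).1.1; pose y N := (f N).1.2; pose m N := (f N).2.
have l0 N i : 0 <= l N i by have [_ h _ _ _] := fgood N; have [] := h i.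
have LX N n k : (m N <= n)%N -> (k < N)%N -> L 'X^k = \sum_(i < n) l N i * y N i ^+ k.
  move=> mn kN; have [_ _ _ _ h] := fgood N; rewrite (h n)// ?size_polyXn//.
  by apply: eq_bigr => i _; rewrite hornerXn.
have M0 A : 0 <= A -> 0 <= M A.
  move=> A0; apply: le_trans (PM A 0%N 0 _); last by rewrite normr0.
  by apply: sumr_ge0 => k _; rewrite sqr_ge0.
have le_even N i k : (2 * k < N)%N -> l N i * y N i ^+ (2 * k) <= L 'X^(2 * k).
  move=> kN; rewrite (LX N (maxn (m N) i.+1)) ?leq_maxl//.
  have im : (i < maxn (m N) i.+1)%N by rewrite leq_max ltnSn orbT.
  rewrite (bigD1 (Ordinal im))//= lerDl; apply: sumr_ge0 => j _.
  by rewrite mulr_ge0// exprM exprn_ge0// sqr_ge0.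
(* If the node [i] were in [[-A, A]], so would be all earlier ones; each satisfies
   [1 <= M A * l N j], and the weights add up to [L 1], so [i.+1 <= M A * L 1]. *)
have far A N I i : 0 <= A -> (0 < N)%N -> M A * L 1 < I%:R -> (I <= i < m N)%N -> A < `|y N i|.
  move=> A0 N0 MI /andP[Ii im]; rewrite ltNge; apply/negP => yA.
  have [_ _ h1 h2 _] := fgood N.
  have lo j : (j < i.+1)%N -> 1 <= M A * l N j.
    move=> ji; have jm : (j < m N)%N by rewrite (leq_ltn_trans _ im).
    apply: le_trans (h1 j jm) _; apply: ler_wpM2r; first exact: l0.
    by apply: PM; apply: le_trans yA; apply: h2; rewrite -ltnS ji.
  have : i.+1%:R <= M A * L 1.
    rewrite -(expr0 'X) (LX N (m N) 0%N)// -(subnKC im) big_split_ord /= mulrDr.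
    rewrite -[leLHS]addr0; apply: lerD; last first.
      by rewrite mulr_ge0 ?M0// sumr_ge0// => j _; rewrite mulr1.
    rewrite mulr_sumr -[i.+1 in leLHS]card_ord -sum1_card natr_sum; apply: ler_sum => j _.
    by rewrite mulr1; exact: lo.
  apply/negP; rewrite -ltNge (lt_le_trans MI)// ler_nat (leq_trans Ii)//.
(* A Chebyshev bound, uniform in [N]: from index [I] on, the nodes of nonzero weight exceed
   [A >= 1], so [|y| ^+ k * A ^+ 2 <= y ^+ (2 * k.+1)], and [A] is such that the even moment [s] is
   at most [e * A ^+ 2]. *)
have tail k e : 0 < e -> exists I0, forall I N, (I0 <= I)%N -> (2 * k.+1 < N)%N ->
    `|L 'X^k - \sum_(i < I) l N i * y N i ^+ k| <= e.
  move=> e0; pose s := L 'X^(2 * k.+1); pose A := 1 + `|s| / e.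
  have se0 : 0 <= `|s| / e by rewrite divr_ge0// ltW.
  have A1 : 1 <= A by rewrite /A lerDl.
  have A0 : 0 <= A := le_trans ler01 A1.
  have sA : s <= e * A ^+ 2.
    apply: (@le_trans _ _ (e * A)).
      by rewrite /A mulrDr mulr1 mulrC divfK ?gt_eqF// (le_trans (ler_norm s))// lerDr ltW.
    by rewrite ler_pM2l// expr2 ler_peMl.
  exists (Num.truncn (M A * L 1)).+1 => I N II kN.
  have MI : M A * L 1 < I%:R.
    by apply: lt_le_trans (truncnS_gt _) _; rewrite ler_nat.
  have N0 : (0 < N)%N by rewrite (leq_ltn_trans _ kN).
  pose n := maxn (m N) I; have In : (I <= n)%N by rewrite leq_maxr.
  rewrite (LX N n) ?leq_maxl//; last by lia.
  rewrite -(subnKC In) big_split_ord /= addrAC subrr add0r.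
  apply: le_trans (ler_norm_sum _ _ _) _.
  have : \sum_(i < n - I) l N (I + i) * y N (I + i) ^+ (2 * k.+1) <= s.
    rewrite [leRHS](_ : s = \sum_(i < I + (n - I)) l N i * y N i ^+ (2 * k.+1)); last first.
      by rewrite subnKC // /s (LX N n) ?leq_maxl.
    rewrite big_split_ord /= lerDr.
    by apply: sumr_ge0 => j _; rewrite mulr_ge0// exprM exprn_ge0// sqr_ge0.
  move=> /le_trans/(_ sA) H.
  have A20 : 0 < A ^+ 2 by rewrite exprn_gt0// (lt_le_trans ltr01).
  rewrite -(ler_pM2r A20); apply: le_trans H; rewrite mulr_suml; apply: ler_sum => i _.
  have [li0|li0] := eqVneq (l N (I + i)) 0; first by rewrite li0 !mul0r normr0 mul0r.
  have im : (I + i < m N)%N.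
    rewrite ltnNge; apply/negP => mi; move/eqP: li0; apply.
    by have [_ h _ _ _] := fgood N; have [_] := h (I + i)%N; exact.
  have yA := far A N I (I + i)%N A0 N0 MI; rewrite leq_addr im in yA.
  have {}yA := ltW (yA isT).
  rewrite normrM (ger0_norm (l0 _ _)) -mulrA; apply: ler_wpM2l; first exact: l0.
  rewrite -[leRHS]ger0_norm; last by rewrite exprM exprn_ge0// sqr_ge0.
  rewrite !normrX; have -> : (2 * k.+1 = k + (k + 2))%N by lia.
  rewrite !exprD; apply: ler_wpM2l; first by rewrite exprn_ge0.
  apply: (@le_trans _ _ (`|y N (I + i)%N| ^+ 2)); first by rewrite ler_pXn2r ?nnegrE.
  by rewrite ler_peMl ?exprn_ge0// exprn_ege1// (le_trans A1).
(* An ultrafilter finer than the filter at infinity yields limits for all [i] and [k] without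
   extracting subsequences. *)
have [U [UU sU]] := ultraFilterLemma (eventually_filter : ProperFilter \oo).
have nearU K : \forall N \near U, (K < N)%N by apply: sU; exact: nbhs_infty_gt.
have /choice[b bE] : forall i, exists b : nat -> R, forall k, (fun N => l N i * y N i ^+ k) @ U --> b k.
  move=> i; suff /choice[g gE] : forall k, exists g : R, (fun N => l N i * y N i ^+ k) @ U --> g.
    by exists g.
  move=> k.
  (* The bound comes from [|y| ^+ k <= 1 + y ^+ (2 * k)]. *)
  apply: (@ultralimit _ _ (L 'X^(2 * 0) + L 'X^(2 * k))) => //.
  apply: filterS (nearU (2 * k)%N) => N kN.
  have := le_even N i 0%N; rewrite muln0 (leq_ltn_trans _ kN)// => /(_ isT) h0.
  have h1 := le_even N i k kN; apply: le_trans (lerD h0 h1).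
  rewrite normrM (ger0_norm (l0 _ _)) -mulrDr; apply: ler_wpM2l => //.
  rewrite [(2 * k)%N]mulnC exprM normrX -(real_normK (num_real (_ ^+ k))) normrX expr0.
  by have := sqr_ge0 (`|y N i| ^+ k - 1); move: (_ ^+ k) => z; nra.
(* This relation forces the [b i k] to be the moments of one atom [yl i] of mass [b i 0]. If that
   mass is zero, taking [k = k'] shows that all the [b i k] vanish, whatever [yl i] is. *)
have bb i k k' : b i k * b i k' = b i 0%N * b i (k + k')%N.
  apply: (@real_cvg_unique _ _ U (fun N => l N i * y N i ^+ k * (l N i * y N i ^+ k'))).
  - exact: cvgM (bE i k) (bE i k').
  - have -> : (fun N => l N i * y N i ^+ k * (l N i * y N i ^+ k')) =
      (fun N => l N i * y N i ^+ 0 * (l N i * y N i ^+ (k + k'))).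
      by apply/funext => N; rewrite exprD; ring.
    exact: cvgM (bE i 0%N) (bE i (k + k')%N).
have b0 i : 0 <= b i 0%N.
  apply: (ler_cvg_to (cvg_cst 0) (bE i 0%N)).
  by apply: nearW => N; rewrite expr0 mulr1.
pose yl i := b i 1%N / b i 0%N.
have bk i k : b i k = b i 0%N * yl i ^+ k.
  have [bi0|bi0] := eqVneq (b i 0%N) 0.
    by have := bb i k k; rewrite bi0 !mul0r => /eqP; rewrite mulf_eq0 orbb => /eqP.
  elim: k => [|k IH]; first by rewrite expr0 mulr1.
  apply: (mulfI bi0); rewrite -(bb i 1%N k) IH /yl exprS; field.
  by [].
exists (b^~ 0%N), yl; split=> //.
- have : 1 <= M 0 * b 0%N 0%N.
    have cM : (fun N => M 0 * (l N 0%N * y N 0%N ^+ 0)) @ U --> M 0 * b 0%N 0%N.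
      by apply: cvgM; [exact: cvg_cst|exact: bE].
    have c1 : (fun=> 1 : R) @ U --> (1 : R) by exact: cvg_cst.
    apply: (ler_cvg_to c1 cM).
    apply: nearW => N; have [[y0 m0] _ h _ _] := fgood N.
    rewrite expr0 mulr1; apply: le_trans (h _ m0) _; apply: ler_wpM2r; first exact: l0.
    by apply: PM; rewrite y0 normr0.
  by have := b0 0%N; rewrite le_eqVlt => /predU1P[<-|//]; rewrite mulr0 ler10.
- rewrite /yl (_ : b 0%N 1%N = 0) ?mul0r//.
  apply: (@real_cvg_unique _ _ U (fun N => l N 0%N * y N 0%N ^+ 1)) => //.
  have -> : (fun N => l N 0%N * y N 0%N ^+ 1) = cst 0; last exact: cvg_cst.
  by apply/funext => N; have [[y0 _] _ _ _ _] := fgood N; rewrite /y y0 expr1 mulr0.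
- move=> k; under eq_fun do under eq_bigr do rewrite -bk.
  apply/cvgrPdist_le => e e0; have [I0 H] := tail k e e0.
  exists I0 => // I /= II.
  (* For fixed [I], the tail bound holds for almost all [N] along [U] and passes to the limit. *)
  have cU : (fun N => `|L 'X^k - \sum_(i < I) l N i * y N i ^+ k|) @ U --> `|L 'X^k - \sum_(i < I) b i k|.
    apply: cvg_norm; apply: cvgB; first exact: cvg_cst.
    apply: cvg_big => [|i _]; [exact: add_continuous|exact: bE].
  apply: (ler_cvg_to cU (cvg_cst e)).
  by apply: filterS (nearU (2 * k.+1)%N) => N; exact: H.
Qed.

End limit_of_quadratures.

(** * Integration of functions of polynomial growth *)

(** A class closed under sums and products that contains polynomials, indicators and [1 / Q]. Its
    members, and therefore their squares, are integrable for every measure with finite moments. *)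
Definition poly_bounded (R : realType) (f : R -> R) :=
  measurable_fun setT f /\ exists p : {poly R}, forall x, `|f x| <= p.[x].

Section poly_bounded.
Context {R : realType}.
Implicit Types (f g : R -> R) (p : {poly R}).

Lemma poly_bounded_horner p : poly_bounded (horner p).
Proof.
split; first by apply: continuous_measurable_fun; exact: continuous_horner.
exists (1 + p * p) => x; rewrite !hornerE.
have := sqr_ge0 (`|p.[x]| - 1); have := real_normK (num_real p.[x]).
by rewrite !expr2; move: `|_| => z; nra.
Qed.

Lemma poly_boundedD f g : poly_bounded f -> poly_bounded g ->
  poly_bounded (fun x => f x + g x).
Proof.
move=> [mf [p fp]] [mg [r gr]]; split; first exact: measurable_funD.
by exists (p + r) => x; rewrite hornerD (le_trans (ler_normD _ _))// lerD.
Qed.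

Lemma poly_boundedM f g : poly_bounded f -> poly_bounded g ->
  poly_bounded (fun x => f x * g x).
Proof.
move=> [mf [p fp]] [mg [r gr]]; split; first exact: measurable_funM.
by exists (p * r) => x; rewrite hornerM normrM ler_pM.
Qed.

Lemma poly_bounded_cst (c : R) : poly_bounded (fun _ : R => c).
Proof. by split; [exact: measurable_cst|exists `|c|%:P => x; rewrite hornerC]. Qed.

Lemma poly_boundedZ c f : poly_bounded f -> poly_bounded (fun x => c * f x).
Proof. exact: poly_boundedM (poly_bounded_cst c). Qed.

Lemma poly_boundedB f g : poly_bounded f -> poly_bounded g ->
  poly_bounded (fun x => f x - g x).
Proof.
move=> pf /(poly_boundedZ (-1)) pg; have := poly_boundedD pf pg.
by under eq_fun do rewrite mulN1r.
Qed.

Lemma poly_bounded_sum (I : Type) (s : seq I) (F : I -> R -> R) :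
  (forall i, poly_bounded (F i)) -> poly_bounded (fun x => \sum_(i <- s) F i x).
Proof.
move=> PF; elim: s => [|i s IH].
  by under eq_fun do rewrite big_nil; exact: poly_bounded_cst.
by under eq_fun do rewrite big_cons; exact: poly_boundedD.
Qed.

Lemma poly_bounded_indic (A : set R) : measurable A -> poly_bounded (\1_A : R -> R).
Proof.
move=> mA; split; first exact: measurable_indic.
exists 1 => x; rewrite hornerE indicE ger0_norm//.
by case: (_ \in _).
Qed.

Lemma poly_bounded_invq (a b : R) : 0 < b ->
  poly_bounded (fun x => (quadratic a b).[x]^-1).
Proof.
move=> b0; have Q0 x : 0 < (quadratic a b).[x].
  by rewrite horner_quadratic ltr_wpDl ?sqr_ge0// exprn_gt0.
split.
  apply: continuous_measurable_fun => x; apply: (@cvgV _ _ _ _ (horner (quadratic a b))).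
    by rewrite gt_eqF.
  exact: continuous_horner.
exists ((b ^+ 2)^-1)%:P => x; rewrite hornerC gtr0_norm ?invr_gt0// lef_pV2 ?posrE ?exprn_gt0//.
by rewrite horner_quadratic lerDr sqr_ge0.
Qed.

End poly_bounded.

Section expectation.
Context {R : realType} {mu : {measure set R -> \bar R}}.
Hypothesis mom : finite_moments mu.
Hint Resolve poly_bounded_horner poly_boundedD poly_boundedM poly_bounded_cst
  poly_boundedZ poly_boundedB : core.
Implicit Types (f g : R -> R) (p : {poly R}).

Local Notation E f := (\int[mu]_x f x)%R.

Lemma integrable_horner p : mu.-integrable setT (fun x => (p.[x])%:E).
Proof.
have H n (c : nat -> R) : mu.-integrable setT (fun x => (\sum_(i < n) c i * x ^+ i)%:E).
  elim: n => [|n IH].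
    by under eq_fun do rewrite big_ord0; exact: integrable0.
  under eq_fun do rewrite big_ord_recr /= EFinD EFinM.
  by apply: integrableD => //; apply: integrableZl => //; exact: mom.
by under eq_fun do rewrite horner_coef; exact: H.
Qed.

Lemma integrable_poly_bounded f : poly_bounded f -> mu.-integrable setT (EFin \o f).
Proof.
move=> [mf [p fp]]; apply: (le_integrable _ _ _ (integrable_horner p)) => //.
  exact/measurable_EFinP.
by move=> x _ /=; rewrite lee_fin (le_trans (fp x))// ler_norm.
Qed.

Lemma expD f g : poly_bounded f -> poly_bounded g ->
  E (fun x => f x + g x) = E f + E g.
Proof. by move=> pf pg; rewrite RintegralD//; exact: integrable_poly_bounded. Qed.

Lemma expB f g : poly_bounded f -> poly_bounded g ->
  E (fun x => f x - g x) = E f - E g.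
Proof. by move=> pf pg; rewrite RintegralB//; exact: integrable_poly_bounded. Qed.

Lemma expZ c f : poly_bounded f -> E (fun x => c * f x) = c * E f.
Proof. by move=> pf; rewrite RintegralZl//; exact: integrable_poly_bounded. Qed.

Lemma exp_le f g : poly_bounded f -> poly_bounded g -> (forall x, f x <= g x) ->
  E f <= E g.
Proof. by move=> pf pg fg; apply: le_Rintegral => //; exact: integrable_poly_bounded. Qed.

Lemma exp_ge0 f : (forall x, 0 <= f x) -> 0 <= E f.
Proof. by move=> f0; exact: Rintegral_ge0. Qed.

Lemma exp_EFin f : poly_bounded f -> (\int[mu]_x (f x)%:E)%E = (E f)%:E.
Proof.
move=> pf; rewrite /Rintegral fineK//.
exact: (integrable_fin_num _ (integrable_poly_bounded pf)).
Qed.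

Lemma fin_num_finite_moments (A : set R) : measurable A -> mu A \is a fin_num.
Proof.
move=> mA; have := integrable_fin_num measurableT (integrable_poly_bounded (poly_bounded_indic mA)).
by rewrite integral_indic// setIT.
Qed.

Lemma exp_indic (A : set R) : measurable A -> E (\1_A) = fine (mu A).
Proof. by move=> mA; rewrite /Rintegral integral_indic// setIT. Qed.

Lemma exp_indic1 f (a : R) : poly_bounded f ->
  E (fun x => f x * \1_[set a] x) = f a * fine (mu [set a]).
Proof.
move=> pf; rewrite -exp_indic// -expZ//; last exact: poly_bounded_indic.
apply: eq_Rintegral => x _; rewrite indicE; case: (boolP (x \in [set a])).
  by rewrite inE => ->.
by rewrite !mulr0.
Qed.

Lemma weighted_functional g : poly_bounded g ->
  exists T : {scalar {poly R}}, forall p, T p = E (fun x => p.[x] * g x).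
Proof.
move=> pg; pose T p := E (fun x => p.[x] * g x).
have Tlin : linear_for *%R T.
  move=> c p r; rewrite /T -expZ; last exact: poly_boundedM.
  rewrite -expD; [|by apply: poly_boundedZ; exact: poly_boundedM|exact: poly_boundedM].
  by apply: eq_Rintegral => x _; rewrite hornerD hornerZ; ring.
exists (HB.pack_for {scalar {poly R}} T (GRing.isLinear.Build _ _ _ _ T Tlin)) => p.
reflexivity.
Qed.

Lemma exp_cvg (f_ : nat -> R -> R) f (C : R) :
  (forall n, poly_bounded (f_ n)) -> (forall n x, `|f_ n x| <= C) ->
  (forall x, (fun n => f_ n x) @ \oo --> f x) ->
  (fun n => E (f_ n)) @ \oo --> E f.
Proof.
move=> pf fC fcvg.
have iC : mu.-integrable setT (EFin \o cst C).
  by apply: integrable_poly_bounded; exact: poly_bounded_cst.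
have mf_ n : measurable_fun setT (EFin \o f_ n) by apply/measurable_EFinP; case: (pf n).
have fc x : setT x -> (EFin \o f_ n) x @[n --> \oo] --> (EFin \o f) x.
  by move=> _; apply: cvg_EFin; [exact: nearW|exact: fcvg].
have pf' : poly_bounded f.
  split; first by apply: (measurable_fun_cvg (h := f_)) => [n|x _]; [case: (pf n)|exact: fcvg].
  exists C%:P => x; rewrite hornerC.
  have C' : (fun=> C) @ \oo --> C by exact: cvg_cst.
  have nC : \forall n \near \oo, `|f_ n x| <= C by near=> n.
  exact: (ler_cvg_to (cvg_norm (fcvg x)) C' nC).
have Cfin (x : R) : setT x -> (EFin \o cst C) x \is a fin_num by [].
have fle n x : setT x -> (`|(EFin \o f_ n) x| <= (EFin \o cst C) x)%E.
  by move=> _ /=; rewrite lee_fin.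
have := @dominated_cvg _ _ _ mu setT measurableT _ _ _ mf_ fc Cfin iC fle.
rewrite [X in _ --> X -> _]/= exp_EFin// => /fine_cvg; exact.
Unshelve. all: by end_near.
Qed.

(** Expansion of the nonnegative integral of [(g - s) ^+ 2], where [s] is the partial Fourier sum of
    [g]. *)
Lemma bessel (P : nat -> {poly R}) g N : poly_bounded g ->
  (forall n m, E (fun x => (P n).[x] * (P m).[x]) = (n == m)%:R) ->
  \sum_(n < N) E (fun x => (P n).[x] * g x) ^+ 2 <= E (fun x => g x ^+ 2).
Proof.
move=> pg PP; have [T TE] := weighted_functional pg.
have [L LE] := weighted_functional (poly_bounded_cst 1).
pose c n := T (P n); pose s := \sum_(n < N) c n *: P n.
have Ts : T s = \sum_(n < N) c n ^+ 2.
  by rewrite linear_sum; apply: eq_bigr => n _; rewrite scalarZ expr2.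
have LPP n m : L (P n * P m) = (n == m)%:R.
  by rewrite LE -PP; apply: eq_Rintegral => x _; rewrite hornerM mulr1.
have Ls : L (s * s) = \sum_(n < N) c n ^+ 2.
  rewrite {1}/s mulr_suml linear_sum; apply: eq_bigr => n _.
  rewrite -scalerAl scalarZ expr2; congr (_ * _).
  rewrite mulr_sumr linear_sum (bigD1 n)//= big1 ?addr0 => [|m mn].
    by rewrite -scalerAr scalarZ LPP eqxx mulr1.
  by rewrite -scalerAr scalarZ LPP (inj_eq val_inj) eq_sym (negbTE mn) mulr0.
rewrite (eq_bigr (fun n : 'I_N => c n ^+ 2)); last by move=> n _; rewrite /c TE.
have : 0 <= E (fun x => (g x - s.[x]) ^+ 2) by apply: exp_ge0 => x; rewrite sqr_ge0.
have -> : E (fun x => (g x - s.[x]) ^+ 2) =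
    E (fun x => (g x ^+ 2 - 2 * (s.[x] * g x)) + (s * s).[x] * 1).
  by apply: eq_Rintegral => x _; rewrite hornerM; ring.
have pg2 : poly_bounded (fun x => g x ^+ 2) by apply: poly_boundedM.
have psg : poly_bounded (fun x => s.[x] * g x) by apply: poly_boundedM.
rewrite expD; [|by apply: poly_boundedB => //; exact: poly_boundedZ|exact: poly_boundedM].
rewrite expB//; last exact: poly_boundedZ.
by rewrite expZ// -TE -LE Ts Ls; lra.
Qed.

End expectation.

(** * Bounds on the evaluations obtained from measures *)

Section evaluation_bounds_of_measures.
Context {R : realType}.
Implicit Types (mu nu : {measure set R -> \bar R}) (f g : R -> R) (p : {poly R}).

Local Notation "''E_' mu f" := (\int[mu]_x f x)%R (at level 10, mu at level 8, f at level 9).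

Lemma moment_functional mu : finite_moments mu ->
  exists L : {scalar {poly R}}, forall p, L p = 'E_mu (fun x => p.[x]).
Proof.
move=> mom; have [L LE] := weighted_functional mom (poly_bounded_cst 1).
by exists L => p; rewrite LE; apply: eq_Rintegral => x _; rewrite mulr1.
Qed.

Lemma orthonormal_polysP mu (P : nat -> {poly R}) : finite_moments mu ->
  orthonormal_polys mu P ->
  (forall n, size (P n) = n.+1) /\
  (forall n m, 'E_mu (fun x => (P n).[x] * (P m).[x]) = (n == m)%:R).
Proof.
move=> mom [sP oP]; split=> [n|n m]; first by have [] := sP n.
by have := oP n m; rewrite exp_EFin//; [case|apply: poly_boundedM; exact: poly_bounded_horner].
Qed.

Lemma scalar_moments (L L' : {scalar {poly R}}) :
  (forall k, L 'X^k = L' 'X^k) -> forall p, L p = L' p.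
Proof.
move=> LL p; rewrite -[p]coefK poly_def !linear_sum; apply: eq_bigr => i _.
by rewrite !scalarZ LL.
Qed.

Lemma quadratic_gt0 (a b x : R) : 0 < b -> 0 < (quadratic a b).[x].
Proof. by move=> b0; rewrite horner_quadratic ltr_wpDl ?sqr_ge0// exprn_gt0. Qed.

(** The functions [b ^+ 2 / Q] with [b = 1 / n.+1]: they take values in [0, 1] and tend to the
    indicator of [a]. *)
Let bump (a : R) n x := n.+1%:R^-1 ^+ 2 * (quadratic a n.+1%:R^-1).[x]^-1 : R.

Let bump_ge0 a n x : 0 <= bump a n x.
Proof. by rewrite mulr_ge0 ?sqr_ge0// invr_ge0 ltW// quadratic_gt0. Qed.

Let bump_le1 a n x : bump a n x <= 1.
Proof.
by rewrite /bump ler_pdivrMr ?quadratic_gt0// mul1r horner_quadratic lerDr sqr_ge0.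
Qed.

Let poly_bounded_bump a n : poly_bounded (bump a n).
Proof. by apply: poly_boundedZ; exact: poly_bounded_invq. Qed.

Let bump_cvg a x : bump a n x @[n --> \oo] --> (\1_[set a] x : R).
Proof.
have [->|xa] := eqVneq x a.
  rewrite indicE mem_set//= -[X in _ --> X](_ : 1 = _)//.
  have -> : (fun n => bump a n a) = cst 1; last exact: cvg_cst.
  apply/funext => n; have n0 : n.+1%:R^-1 ^+ 2 != 0 :> R by rewrite sqrf_eq0 invr_eq0 pnatr_eq0.
  by rewrite /bump horner_quadratic subrr expr0n add0r divff.
rewrite indicE memNset; last by move=> /= /eqP; apply/negP.
have h : (fun n => n.+1%:R^-1 : R) @ \oo --> (0 : R) by exact: cvg_harmonic.
have h2 : (fun n => n.+1%:R^-1 ^+ 2 : R) @ \oo --> (0 : R).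
  by rewrite -[X in _ --> X](mulr0 0); exact: cvgM.
rewrite -[X in _ --> X](mul0r (((x - a) ^+ 2 + 0)^-1)).
apply: cvgM => //; under eq_fun do rewrite horner_quadratic.
apply: (@cvgV _ _ _ _ (fun n => (x - a) ^+ 2 + n.+1%:R^-1 ^+ 2)).
  by rewrite addr0 sqrf_eq0 subr_eq0.
by apply: cvgD => //; exact: cvg_cst.
Qed.

Section bound.
Variables (mu : {measure set R -> \bar R}) (P : nat -> {poly R}) (a : R).
Hypothesis mom : finite_moments mu.
Hypothesis sizeP : forall n, size (P n) = n.+1.
Hypothesis orthoP : forall n m, 'E_mu (fun x => (P n).[x] * (P m).[x]) = (n == m)%:R.

(** Here [T p] is the integral of [p / Q], and Bessel's inequality for [1 / Q] and [(X - a) / Q]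
    bounds its two sums; the conditions on [F] remain. *)
Lemma christoffel_bounded_measure b c C A : 0 < b -> 0 < c -> 0 <= A ->
  exists M, forall (F : {scalar {poly R}}) N,
    (forall p, (size p <= N)%N -> F (quadratic a b * p) = 0) ->
    \sum_(n < N) F (P n) ^+ 2 <= C ->
    \sum_(n < N) F (('X - a%:P) * P n) ^+ 2 <= C ->
    c <= `|F 1| ->
    forall w, `|w| <= A -> christoffel P N w <= M.
Proof.
move=> b0 c0 A0; have pi := poly_bounded_invq a b0.
set iq := (fun x => _) in pi.
have pai : poly_bounded (fun x => ('X - a%:P).[x] * iq x).
  exact: poly_boundedM (poly_bounded_horner _) pi.
have [L LE] := moment_functional mom.
have [T TE] := weighted_functional mom pi.
have LP n m : L (P n * P m) = (n == m)%:R.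
  by rewrite LE -orthoP; apply: eq_Rintegral => x _; rewrite hornerM.
pose B1 := 'E_mu (fun x => iq x ^+ 2).
pose B2 := 'E_mu (fun x => (('X - a%:P).[x] * iq x) ^+ 2).
have [M HM] := christoffel_bounded sizeP LP a (Num.max C (Num.max B1 B2)) b0 c0 A0.
exists M => F N F0 FC FYC cF; apply: (HM T F N) => //.
- move=> p; rewrite TE LE; apply: eq_Rintegral => x _.
  by rewrite hornerM mulrAC divff ?mul1r// gt_eqF// quadratic_gt0.
- rewrite !le_max; apply/orP; right; apply/orP; left.
  under eq_bigr do rewrite TE.
  exact: bessel.
- rewrite !le_max; apply/orP; right; apply/orP; right.
  rewrite (eq_bigr (fun n : 'I_N => 'E_mu (fun x => (P n).[x] * (('X - a%:P).[x] * iq x)) ^+ 2)).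
    exact: bessel.
  move=> n _; rewrite TE; congr (_ ^+ 2); apply: eq_Rintegral => x _.
  by rewrite hornerM; ring.
- by rewrite le_max FC.
- by rewrite le_max FYC.
Qed.

(** [F p] is the integral of [p / Q] against [mu - nu]; it kills the multiples of [Q] by equality of
    the moments. The [P n] are orthonormal for [nu] too, so Bessel's inequality applies to both
    measures. *)
Lemma christoffel_bounded_of_moments nu : finite_moments nu ->
  (forall k : nat, (\int[nu]_x ((x ^+ k)%R)%:E = \int[mu]_x ((x ^+ k)%R)%:E)%E) ->
  nu [set a] != mu [set a] ->
  forall A, 0 <= A -> exists M, forall N w, `|w| <= A -> christoffel P N w <= M.
Proof.
move=> nmom numu nua A A0.
have [L LE] := moment_functional mom.
have [L' LE'] := moment_functional nmom.
have LL : forall p, L p = L' p.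
  apply: scalar_moments => k; rewrite LE LE' /Rintegral.
  by congr fine; under eq_integral do rewrite hornerXn; rewrite -numu; under [RHS]eq_integral do rewrite hornerXn.
have orthoP' n m : 'E_nu (fun x => (P n).[x] * (P m).[x]) = (n == m)%:R.
  have H (K : {measure set R -> \bar R}) : 'E_K (fun x => (P n).[x] * (P m).[x]) = 'E_K (fun x => (P n * P m).[x]).
    by apply: eq_Rintegral => x _; rewrite hornerM.
  by rewrite -orthoP !H -LE -LE' LL.
(* If no bump separated [mu] from [nu], dominated convergence would give them the same mass at
   [a]. *)
have [k Hk] : exists k, 'E_mu (bump a k) != 'E_nu (bump a k).
  apply: contrapT => nH; move/eqP: nua; apply.
  have H k : 'E_mu (bump a k) = 'E_nu (bump a k).
    by apply/eqP/negPn/negP => kH; apply: nH; exists k.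
  have fa (K : {measure set R -> \bar R}) : finite_moments K ->
      (fun k => 'E_K (bump a k)) @ \oo --> fine (K [set a]).
    move=> Km; rewrite -exp_indic//; apply: (@exp_cvg _ _ Km _ _ 1) => // n x.
    by rewrite ger0_norm.
  rewrite -(fineK (fin_num_finite_moments mom (measurable_set1 a))).
  rewrite -(fineK (fin_num_finite_moments nmom (measurable_set1 a))); congr EFin.
  apply: real_cvg_unique (fa _ nmom) _.
  have -> : (fun k => 'E_nu (bump a k)) = (fun k => 'E_mu (bump a k)).
    by apply/funext => k; rewrite H.
  exact: fa.
pose b : R := k.+1%:R^-1; have b0 : 0 < b by rewrite invr_gt0.
have pi := poly_bounded_invq a b0.
set iq := (fun x => _) in pi.
have pai : poly_bounded (fun x => ('X - a%:P).[x] * iq x).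
  exact: poly_boundedM (poly_bounded_horner _) pi.
have [T TE] := weighted_functional mom pi.
have [T' TE'] := weighted_functional nmom pi.
have T1 : T 1 != T' 1.
  apply: contraNneq Hk => T1; rewrite /bump !expZ// -/b -/iq.
  have E1 (K : {measure set R -> \bar R}) : 'E_K iq = 'E_K (fun x => (1 : {poly R}).[x] * iq x).
    by apply: eq_Rintegral => x _; rewrite hornerE mul1r.
  by rewrite !E1 -TE -TE' T1.
pose f p := T p - T' p.
have flin : linear_for *%R f by move=> c p r; rewrite /f !linearD /= !scalarZ; ring.
have [F FE] : exists F : {scalar {poly R}}, forall p, F p = f p.
  by exists (HB.pack_for {scalar {poly R}} f (GRing.isLinear.Build _ _ _ _ f flin)).
pose C := 2 * ('E_mu (fun x => iq x ^+ 2) + 'E_nu (fun x => iq x ^+ 2)).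
pose C' := 2 * ('E_mu (fun x => (('X - a%:P).[x] * iq x) ^+ 2) +
                'E_nu (fun x => (('X - a%:P).[x] * iq x) ^+ 2)).
have c0 : 0 < `|F 1| by rewrite normr_gt0 FE subr_eq0.
have [M HM] := christoffel_bounded_measure (Num.max C C') b0 c0 A0.
have sq2 (u v : R) : (u - v) ^+ 2 <= 2 * (u ^+ 2 + v ^+ 2).
  by have := sqr_ge0 (u + v); rewrite !expr2; lra.
have QK (K : {measure set R -> \bar R}) p :
    'E_K (fun x => (quadratic a b * p).[x] * iq x) = 'E_K (fun x => p.[x]).
  apply: eq_Rintegral => x _.
  by rewrite hornerM mulrAC divff ?mul1r// gt_eqF// quadratic_gt0.
have YK (K : {measure set R -> \bar R}) n :
    'E_K (fun x => (('X - a%:P) * P n).[x] * iq x) =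
    'E_K (fun x => (P n).[x] * (('X - a%:P).[x] * iq x)).
  by apply: eq_Rintegral => x _; rewrite hornerM; ring.
have FF p : F p ^+ 2 <= 2 * (T p ^+ 2 + T' p ^+ 2) by rewrite FE; exact: sq2.
exists M => N w wA; apply: (HM F N) => //.
- by move=> p _; rewrite FE /f TE TE' !QK -LE -LE' LL subrr.
- rewrite le_max; apply/orP; left.
  apply: le_trans (ler_sum _ (fun (n : 'I_N) _ => FF (P n))) _.
  rewrite -mulr_sumr big_split /= ler_wpM2l// lerD//.
    by under eq_bigr do rewrite TE; exact: bessel.
  by under eq_bigr do rewrite TE'; exact: bessel.
- rewrite le_max; apply/orP; right.
  apply: le_trans (ler_sum _ (fun (n : 'I_N) _ => FF (('X - a%:P) * P n))) _.
  rewrite -mulr_sumr big_split /= ler_wpM2l// lerD//.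
    by under eq_bigr do rewrite TE YK; exact: bessel.
  by under eq_bigr do rewrite TE' YK; exact: bessel.
Qed.

(* If the projections of [\1_[set a]] on the polynomials stay away from it, the
   residual [\1_[set a] - s] is orthogonal to the polynomials of low degree, and
   plays the role of the difference of two measures with the same moments. *)
Lemma christoffel_bounded_of_atom d0 : 0 < d0 ->
  (forall p, d0 <= 'E_mu (fun x => (\1_[set a] x - p.[x]) ^+ 2)) ->
  forall A, 0 <= A -> exists M, forall N w, `|w| <= A -> christoffel P N w <= M.
Proof.
move=> d0_gt0 dist_ge A A0; pose e := \1_[set a] : R -> R.
pose m := fine (mu [set a]).
have ee x : e x ^+ 2 = e x by rewrite /e indicE; case: (_ \in _); rewrite !expr2 ?mulr1 ?mulr0.
have pe : poly_bounded e by apply: poly_bounded_indic.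
have [L LE] := moment_functional mom.
have LP n m' : L (P n * P m') = (n == m')%:R.
  by rewrite LE -orthoP; apply: eq_Rintegral => x _; rewrite hornerM.
(* The orthogonal projection of [e] on degrees < [N]: the integral of [e * P k] is [m * (P
   k).[a]]. *)
pose S N : {poly R} := \sum_(k < N) (m * (P k).[a]) *: P k.
have Sa N : (S N).[a] = m * christoffel P N a.
  rewrite /S horner_sum /christoffel mulr_sumr; apply: eq_bigr => k _.
  by rewrite hornerZ expr2 mulrA.
have LS N p : (size p <= N)%N -> L (p * S N) = m * p.[a].
  move=> sp; rewrite {2}(orthonormal_expansion sizeP LP sp) horner_sum mulr_sumr.
  rewrite /S mulr_sumr linear_sum; apply: eq_bigr => k _.
  by rewrite -scalerAr scalarZ hornerZ; ring.
have sS N : (size (S N) <= N)%N.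
  rewrite /S; elim/big_ind: _ => [|q1 q2 h1 h2|k _].
  - by rewrite size_poly0.
  - by rewrite (leq_trans (size_polyD _ _))// geq_max h1.
  - by rewrite (leq_trans (size_scale_leq _ _))// sizeP.
pose g N x := e x - (S N).[x].
have pg N : poly_bounded (g N) by apply: poly_boundedB => //; exact: poly_bounded_horner.
have Epe p : 'E_mu (fun x => p.[x] * e x) = p.[a] * m.
  by rewrite exp_indic1//; exact: poly_bounded_horner.
have Epg N p : 'E_mu (fun x => p.[x] * g N x) = p.[a] * m - L (p * S N).
  rewrite -Epe LE -expB//; last 2 first.
  - by apply: poly_boundedM => //; exact: poly_bounded_horner.
  - exact: poly_bounded_horner.
  by apply: eq_Rintegral => x _; rewrite hornerM /g; ring.
have Eeg N : 'E_mu (fun x => e x * g N x) = m * (1 - m * christoffel P N a).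
  transitivity ('E_mu (fun x => (1 - S N).[x] * e x)).
    apply: eq_Rintegral => x _; rewrite hornerD hornerN hornerE.
    by rewrite /g mulrBr -expr2 ee; ring.
  by rewrite Epe hornerD hornerN hornerE Sa mulrC.
have EggE N : 'E_mu (fun x => g N x ^+ 2) = m * (1 - m * christoffel P N a).
  have -> : 'E_mu (fun x => g N x ^+ 2) =
     'E_mu (fun x => e x * g N x) - 'E_mu (fun x => (S N).[x] * g N x).
    rewrite -expB//; last 2 first.
    - exact: poly_boundedM.
    - by apply: poly_boundedM => //; exact: poly_bounded_horner.
    by apply: eq_Rintegral => x _; rewrite /g; ring.
  by rewrite Epg LS// Eeg; ring.
have m0 : 0 < m.
  apply: lt_le_trans d0_gt0 _; apply: le_trans (dist_ge (S 0%N)) _.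
  by rewrite [leLHS](EggE 0%N) /christoffel big_ord0 mulr0 subr0 mulr1.
(* [d] is the gap relative to [m]: the squared distance [m * (1 - m * christoffel P N a)] is at
   least [d0]. *)
have [d d_gt0 mK] : exists2 d, 0 < d & forall N, m * christoffel P N a <= 1 - d.
  exists (d0 / m) => [|N]; first by rewrite divr_gt0.
  have := dist_ge (S N); rewrite [leRHS](EggE N) -ler_pdivrMl// mulrC; lra.
have Egg N : 'E_mu (fun x => g N x ^+ 2) <= m.
  have : 0 <= christoffel P N a by apply: sumr_ge0 => k _; rewrite sqr_ge0.
  move=> K0; rewrite EggE; have := mulr_ge0 (ltW m0) K0.
  by move=> K1; rewrite -[leRHS]mulr1 ler_pM2l// gerBl.
pose h k x := bump a k x - e x.
have ph k : poly_bounded (h k) by exact: poly_boundedB.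
(* [k] is fixed before [N], which makes the final bound uniform in [N]. *)
have [k hk] : exists k, 'E_mu (fun x => h k x ^+ 2) <= m * d ^+ 2 / 4.
  have : (fun k => 'E_mu (fun x => h k x ^+ 2)) @ \oo --> 'E_mu (fun=> 0).
    apply: (@exp_cvg _ _ mom _ _ 1) => [k|k x|x].
    - exact: poly_boundedM.
    - rewrite normrX exprn_ile1//; apply/ler_normlP; rewrite /h.
      have := bump_ge0 a k x; have := bump_le1 a k x.
      have : 0 <= e x <= 1 by rewrite /e indicE; case: (_ \in _); rewrite ?lexx ?ler01.
      by case/andP => ? ? ? ?; split; lra.
    - rewrite -[X in _ --> X](_ : (e x - e x) * (e x - e x) = _); last by rewrite subrr mul0r.
      by apply: cvgM; apply: cvgB => //; exact: cvg_cst.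
  rewrite Rintegral_cst// mul0r => /cvgrPdist_le/(_ (m * d ^+ 2 / 4)).
  rewrite divr_gt0 ?mulr_gt0 ?exprn_gt0// => /(_ isT)[k _ /(_ k (leqnn _))].
  by rewrite /= sub0r normrN => hk; exists k; apply: le_trans hk; exact: ler_norm.
pose b : R := k.+1%:R^-1; have b0 : 0 < b by rewrite invr_gt0.
have b20 : 0 < b ^+ 2 by rewrite exprn_gt0.
have pi := poly_bounded_invq a b0.
set iq := (fun x => _) in pi.
have iq0 x : 0 < iq x by rewrite invr_gt0 quadratic_gt0.
have iqb x : iq x <= b ^- 2.
  by rewrite lef_pV2 ?posrE ?quadratic_gt0// horner_quadratic lerDr sqr_ge0.
(* [b ^+ 2 * F 1] will be the integral of [e * g N], at least [m * d], plus an error no less than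
   [- (m * d / 2)]. *)
pose c := m * d / (2 * b ^+ 2).
have c0 : 0 < c by rewrite divr_gt0 ?mulr_gt0.
(* From [iq x <= b ^- 2] and [(x - a) ^+ 2 * iq x <= 1], the squared norm of [g N] being at most
   [m]. *)
pose C := b ^- 2 * (b ^- 2 * m); pose C' := b ^- 2 * m.
have [M HM] := christoffel_bounded_measure (Num.max C C') b0 c0 A0.
exists M => N w wA.
have pgi : poly_bounded (fun x => g N x * iq x) by exact: poly_boundedM.
have [F FE] := weighted_functional mom pgi.
apply: (HM F N) => //.
- move=> p sp; rewrite FE; transitivity ('E_mu (fun x => p.[x] * g N x)).
    apply: eq_Rintegral => x _; rewrite hornerM /iq.
    by field; rewrite gt_eqF// quadratic_gt0.
  by rewrite Epg LS// mulrC subrr.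
- rewrite le_max; apply/orP; left; under eq_bigr do rewrite FE.
  apply: le_trans (bessel mom _ pgi orthoP) _.
  rewrite /C mulrA; apply: (@le_trans _ _ (b ^- 2 * b ^- 2 * 'E_mu (fun x => g N x ^+ 2))).
    rewrite -(expZ mom); last exact: poly_boundedM.
    apply: exp_le => //; [exact: poly_boundedM|by apply: poly_boundedZ; exact: poly_boundedM|].
    move=> x; rewrite exprMn mulrC ler_wpM2r ?sqr_ge0// expr2; apply: ler_pM => //; exact: ltW.
  by rewrite ler_wpM2l// mulr_ge0// invr_ge0 ltW.
- rewrite le_max; apply/orP; right.
  have pygi : poly_bounded (fun x => ('X - a%:P).[x] * (g N x * iq x)).
    exact: poly_boundedM (poly_bounded_horner _) pgi.
  rewrite (eq_bigr (fun n : 'I_N => 'E_mu (fun x => (P n).[x] * (('X - a%:P).[x] * (g N x * iq x))) ^+ 2)); last first.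
    move=> n _; rewrite FE; congr (_ ^+ 2); apply: eq_Rintegral => x _.
    by rewrite hornerM; ring.
  apply: le_trans (bessel mom _ pygi orthoP) _.
  apply: (@le_trans _ _ (b ^- 2 * 'E_mu (fun x => g N x ^+ 2))).
    rewrite -(expZ mom); last exact: poly_boundedM.
    apply: exp_le => //; [exact: poly_boundedM|by apply: poly_boundedZ; exact: poly_boundedM|].
    move=> x; rewrite mulrCA exprMn mulrC ler_wpM2r ?sqr_ge0//.
    apply: le_trans (iqb x); rewrite exprMn expr2 [iq x ^+ 2]expr2 mulrA.
    have iq1 : ('X - a%:P).[x] * ('X - a%:P).[x] * iq x <= 1.
      rewrite ler_pdivrMr ?quadratic_gt0// mul1r horner_quadratic !hornerE -expr2.
      by rewrite lerDl ltW.
    by rewrite -[leRHS]mul1r ler_wpM2r// ltW.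
  by rewrite ler_wpM2l// invr_ge0 ltW.
- rewrite FE; apply: le_trans (ler_norm _).
  have -> : 'E_mu (fun x => (1 : {poly R}).[x] * (g N x * iq x)) = 'E_mu (fun x => g N x * iq x).
    by apply: eq_Rintegral => x _; rewrite hornerC mul1r.
  have E1 : b ^+ 2 * 'E_mu (fun x => g N x * iq x) =
      'E_mu (fun x => e x * g N x) + 'E_mu (fun x => g N x * h k x).
    rewrite -expZ// -expD//; [|exact: poly_boundedM|exact: poly_boundedM].
    by apply: eq_Rintegral => x _; rewrite /h /bump -/b /iq; ring.
  (* Completing the square gives [g * h >= - (d / 4) * g ^+ 2 - d^-1 * h ^+ 2]; the choice of [k]
     keeps each of the two terms within [m * d / 4]. *)
  have E2 : - (d / 4) * m - d^-1 * (m * d ^+ 2 / 4) <= 'E_mu (fun x => g N x * h k x).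
    apply: (@le_trans _ _ (- (d / 4) * 'E_mu (fun x => g N x ^+ 2) -
                           d^-1 * 'E_mu (fun x => h k x ^+ 2))).
      apply: lerB; last by rewrite ler_wpM2l// invr_ge0 ltW.
      by rewrite !mulNr lerN2 ler_wpM2l// divr_ge0// ltW.
    rewrite -!expZ//; [|exact: poly_boundedM|exact: poly_boundedM].
    rewrite -expB//; last 2 first.
    - by apply: poly_boundedZ; exact: poly_boundedM.
    - by apply: poly_boundedZ; exact: poly_boundedM.
    apply: exp_le => //; [|exact: poly_boundedM|].
      by apply: poly_boundedB; apply: poly_boundedZ; exact: poly_boundedM.
    move=> x; rewrite -subr_ge0.
    have -> : g N x * h k x - (- (d / 4) * g N x ^+ 2 - d^-1 * h k x ^+ 2) =
       d^-1 * (d / 2 * g N x + h k x) ^+ 2 by field; rewrite gt_eqF.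
    by rewrite mulr_ge0 ?sqr_ge0// invr_ge0 ltW.
  have E3 : m * d <= 'E_mu (fun x => e x * g N x).
    by rewrite Eeg ler_pM2l// lerBrDr addrC -lerBrDr.
  have cE : b ^+ 2 * c = m * d / 2 by rewrite /c; field; rewrite gt_eqF.
  rewrite -(ler_pM2l b20) E1 cE.
  have dE : d^-1 * (m * d ^+ 2 / 4) = m * d / 4 by field; rewrite gt_eqF.
  by move: E2; rewrite dE; lra.
Qed.

End bound.
End evaluation_bounds_of_measures.

(** * Atomic measures *)

Section measure_of_moments.
Context {R : realType}.
Variables (L : {scalar {poly R}}) (l y : nat -> R).
Hypothesis l0 : forall i, 0 <= l i.
Hypothesis ly : forall k, (fun n : nat => \sum_(i < n) l i * y i ^+ k) @ \oo --> L 'X^k.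

Definition atomic_measure : {measure set R -> \bar R} :=
  mseries (fun i => mscale (NngNum (l0 i)) (\d_(y i))) 0.

Lemma cvg_moments (p : {poly R}) : (fun n : nat => \sum_(i < n) l i * p.[y i]) @ \oo --> L p.
Proof.
have -> : L p = \sum_(k < size p) p`_k * L 'X^k.
  by rewrite -[p in LHS]coefK poly_def linear_sum; apply: eq_bigr => k _; rewrite scalarZ.
have -> : (fun n : nat => \sum_(i < n) l i * p.[y i]) =
    (fun n : nat => \sum_(k < size p) p`_k * \sum_(i < n) l i * y i ^+ k).
  apply/funext => n; under [RHS]eq_bigr do rewrite mulr_sumr.
  rewrite exchange_big /=; apply: eq_bigr => i _; rewrite horner_coef mulr_sumr.
  by apply: eq_bigr => k _; ring.
apply: cvg_big => [|k _]; first exact: add_continuous.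
by apply: cvgM; [exact: cvg_cst|exact: ly].
Qed.

Lemma integral_atomic_measure (p : {poly R}) : (forall x, 0 <= p.[x]) ->
  (\int[atomic_measure]_x (p.[x])%:E = (L p)%:E)%E.
Proof.
move=> p0; have mp : measurable_fun setT (fun x => (p.[x])%:E).
  by apply/measurable_EFinP; case: (poly_bounded_horner p).
rewrite /atomic_measure ge0_integral_measure_series//; last by move=> x _; rewrite lee_fin.
under eq_eseriesr => n _.
  rewrite ge0_integral_mscale//; last by move=> x _; rewrite lee_fin.
  rewrite integral_dirac// diracT mul1e -EFinM; over.
apply/cvg_lim => //=; under eq_fun do rewrite sumEFin big_mkord.
by apply: cvg_EFin; [exact: nearW|exact: cvg_moments].
Qed.

(** Termwise integration is available for nonnegative polynomials. Integrability follows from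
    [|t| <= 1 + t ^+ 2], and [2 X^k = (X^k + 1)^2 - (X^(2k) + 1)] reaches all the moments by
    linearity. *)
Lemma atomic_measure_moments : finite_moments atomic_measure /\
  forall k, (\int[atomic_measure]_x ((x ^+ k)%R)%:E = (L 'X^k)%:E)%E.
Proof.
have fm : finite_moments atomic_measure.
  move=> k; pose p : {poly R} := 1 + 'X^k * 'X^k.
  have pE x : p.[x] = 1 + x ^+ k * x ^+ k by rewrite !hornerE.
  have p0 x : 0 <= p.[x] by rewrite pE addr_ge0// -expr2 sqr_ge0.
  have mx : measurable_fun setT (fun x : R => (x ^+ k)%:E).
    by apply/measurable_EFinP; exact: exprn_measurable.
  apply: (@le_integrable _ _ _ _ _ _ _ (fun x => (p.[x])%:E)) => //.
    move=> x _ /=; rewrite lee_fin (ger0_norm (p0 x)) pE.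
    have := sqr_ge0 (`|x ^+ k| - 1); have := real_normK (num_real (x ^+ k)).
    by rewrite !expr2; move: `|_| => z; nra.
  apply/integrableP; split.
    by apply/measurable_EFinP; case: (poly_bounded_horner p).
  under eq_integral do rewrite gee0_abs ?lee_fin ?p0//.
  by rewrite integral_atomic_measure ?ltry.
split=> // k; have [L' L'E] := moment_functional fm.
have LL (p : {poly R}) : (forall x, 0 <= p.[x]) -> L' p = L p.
  by move=> p0; rewrite L'E /Rintegral integral_atomic_measure.
under eq_integral do rewrite -hornerXn.
rewrite (exp_EFin fm (poly_bounded_horner _)) -L'E; congr EFin.
have E : 'X^k = 2^-1 *: (('X^k + 1) ^+ 2 - ('X^k ^+ 2 + 1)) :> {poly R}.
  have -> : ('X^k + 1) ^+ 2 - ('X^k ^+ 2 + 1) = 2%:R *: 'X^k :> {poly R}.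
    by rewrite scaler_nat; ring.
  by rewrite scalerA mulVf ?scale1r// pnatr_eq0.
rewrite E !scalarZ !linearB /= !LL// => x.
  by rewrite !(hornerE, hornerXn) addr_ge0// sqr_ge0.
by rewrite horner_exp sqr_ge0.
Qed.

Lemma atomic_measure_ge (A : set R) : measurable A -> A (y 0%N) ->
  ((l 0%N)%:E <= atomic_measure A)%E.
Proof.
move=> mA Ay.
apply: le_trans (nneseries_lim_ge (u_ := fun i => mscale (NngNum (l0 i)) (\d_(y i)) A) (P := xpredT) 1 _).
  by rewrite big_nat1 /mscale /= diracE mem_set// mule1.
by move=> n _ _; exact: measure_ge0.
Qed.

End measure_of_moments.

Section dmeasure_facts.
Context {R : realType}.
Variables (c x : int -> R).

Lemma dmeasure_atom n : (`|c n|%:E <= dmeasure c x [set x n])%E.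
Proof.
apply: esum_ge; exists [set n]; first by split=> // _ ->.
by rewrite fsbig_set1.
Qed.

Lemma dmeasure_eq0 (A : set R) : (forall n, ~ A (x n)) -> dmeasure c x A = 0%E.
Proof.
move=> Ax; rewrite /dmeasure (_ : [set n | A (x n)] = set0) ?esum_set0//.
by apply/seteqP; split=> // n /Ax.
Qed.

(** The discrete measure of [A] is a supremum over finite sets of indices; by injectivity these give
    disjoint points of [A], whose [nu]-masses add up. *)
Lemma dmeasure_le (nu : {measure set R -> \bar R}) (A : set R) : injective x ->
  measurable A -> (forall n, nu [set x n] = dmeasure c x [set x n]) ->
  (dmeasure c x A <= nu A)%E.
Proof.
move=> xinj mA nuc; apply: ub_ereal_sup => _ [F [finF FA] <-].
apply: (@le_trans _ _ (\sum_(n \in F) nu [set x n])%E).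
  rewrite !fsbig_finite//; apply: lee_sum => n _.
  by rewrite nuc; exact: dmeasure_atom.
rewrite -measure_fin_bigcup//.
- apply: le_measure; rewrite ?inE//; last by move=> _ [n Fn ->]; exact: FA.
  by apply: fin_bigcup_measurable => // n _; exact: measurable_set1.
- by move=> n m _ _ [z [/= -> /xinj]].
Qed.

End dmeasure_facts.

(** The inequalities for [A] and its complement add up to an equality between finite masses, so
    neither is strict. *)
Lemma measure_eq_of_le (R : realType) (mu nu : {measure set R -> \bar R}) :
  finite_moments mu -> finite_moments nu -> nu setT = mu setT ->
  (forall A, measurable A -> (mu A <= nu A)%E) ->
  forall A, measurable A -> nu A = mu A.
Proof.
move=> mom nmom nuT le A mA.
have mAC := measurableC mA.
have dec (K : {measure set R -> \bar R}) : K setT = (K A + K (~` A))%E.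
  by rewrite -measureU ?setUv// setICr.
have fK (K : {measure set R -> \bar R}) B : finite_moments K -> measurable B ->
    exists r, K B = r%:E.
  by move=> Km mB; exists (fine (K B)); rewrite fineK// fin_num_finite_moments.
have := le _ mA; have := le _ mAC; have := nuT; rewrite (dec nu) (dec mu).
have [r1 ->] := fK mu A mom mA; have [r2 ->] := fK mu _ mom mAC.
have [r3 ->] := fK nu A nmom mA; have [r4 ->] := fK nu _ nmom mAC.
rewrite -!EFinD !lee_fin => -[h0] h1 h2.
by congr EFin; lra.
Qed.

Section L2.
Context {R : realType} {mu : {measure set R -> \bar R}}.
Implicit Types f : R -> R.

Lemma Lnorm2_lt f (e : R) : 0 < e ->
  (Lnorm mu 2%:E (EFin \o f) < e%:E)%E <-> (\int[mu]_x (f x ^+ 2)%:E < (e ^+ 2)%:E)%E.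
Proof.
move=> e0; have -> : (\int[mu]_x (f x ^+ 2)%:E = Lnorm mu 2%:E (EFin \o f) `^ 2)%E.
  rewrite powR_Lnorm ?pnatr_eq0//; apply: eq_integral => x _ /=.
  by rewrite ?poweR_EFin powR_mulrn// real_normK// num_real.
have := Lnorm_ge0 mu 2%:E (EFin \o f).
case: (Lnorm _ _ _) => [r| |]; last by rewrite leeNy_eq.
- rewrite lee_fin => r0; rewrite poweR_EFin powR_mulrn// !lte_fin ltr_pXn2r ?nnegrE//.
  exact: ltW.
- by rewrite poweRyr ?pnatr_eq0.
Qed.

Lemma Lnorm2_lty f :
  (Lnorm mu 2%:E (EFin \o f) < +oo)%E <-> (\int[mu]_x (f x ^+ 2)%:E < +oo)%E.
Proof.
have -> : (\int[mu]_x (f x ^+ 2)%:E = Lnorm mu 2%:E (EFin \o f) `^ 2)%E.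
  rewrite powR_Lnorm ?pnatr_eq0//; apply: eq_integral => x _ /=.
  by rewrite ?poweR_EFin powR_mulrn// real_normK// num_real.
have := Lnorm_ge0 mu 2%:E (EFin \o f).
case: (Lnorm _ _ _) => [r| |]; last by rewrite leeNy_eq.
- by rewrite poweR_EFin !ltry.
- by rewrite poweRyr ?pnatr_eq0.
Qed.

End L2.

(** * Density of the polynomials *)

Section density.
Context {R : realType} {mu : {measure set R -> \bar R}}.
Hypothesis mom : finite_moments mu.
Implicit Types (f : R -> R) (p : {poly R}).

Local Notation E f := (\int[mu]_x f x)%R.

Lemma approx_atoms (s : seq R) (c : R -> R) :
  (forall a, a \in s -> forall d, 0 < d ->
     exists p, E (fun x => (\1_[set a] x - p.[x]) ^+ 2) < d) ->
  forall d, 0 < d ->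
    exists p, E (fun x => (\sum_(a <- s) c a * \1_[set a] x - p.[x]) ^+ 2) < d.
Proof.
have pI a : poly_bounded (\1_[set a] : R -> R).
  by apply: poly_bounded_indic; exact: measurable_set1.
elim: s => [_ d d0|a s IH Hs d d0].
  exists 0; have -> : E (fun x => (\sum_(a <- [::]) c a * \1_[set a] x - (0 : {poly R}).[x]) ^+ 2)
      = E (fun=> 0).
    by apply: eq_Rintegral => x _; rewrite big_nil horner0 subr0 expr0n.
  by rewrite Rintegral_cst// mul0r.
have d4 : 0 < d / 4 by rewrite divr_gt0.
have Hs' b : b \in s -> forall d', 0 < d' -> exists p, E (fun x => (\1_[set b] x - p.[x]) ^+ 2) < d'.
  by move=> bs; apply: Hs; rewrite inE bs orbT.
have [p2 H2] := IH Hs' _ d4.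
have c0 : 0 < 4 * (c a ^+ 2 + 1) by rewrite mulr_gt0// ltr_wpDl ?sqr_ge0.
(* With this tolerance, [2 * c a ^+ 2] times the error on the new atom is at most [d / 2], including
   when [c a = 0]. *)
have [p1 H1] := Hs a (mem_head _ _) (d / (4 * (c a ^+ 2 + 1))) (divr_gt0 d0 c0).
exists (c a *: p1 + p2).
pose u x := \1_[set a] x - p1.[x].
pose v x := \sum_(b <- s) c b * \1_[set b] x - p2.[x].
have pu : poly_bounded u by apply: poly_boundedB => //; exact: poly_bounded_horner.
have ps : poly_bounded (fun x => \sum_(b <- s) c b * \1_[set b] x).
  by apply: poly_bounded_sum => b; exact: poly_boundedZ.
have pv : poly_bounded v by apply: poly_boundedB => //; exact: poly_bounded_horner.
have pu2 : poly_bounded (fun x => u x ^+ 2) by exact: poly_boundedM.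
have pv2 : poly_bounded (fun x => v x ^+ 2) by exact: poly_boundedM.
apply: (@le_lt_trans _ _ (E (fun x => 2 * c a ^+ 2 * u x ^+ 2 + 2 * v x ^+ 2))).
  apply: (exp_le mom).
  - have pw : poly_bounded (fun x => \sum_(b <- (a :: s)) c b * \1_[set b] x - (c a *: p1 + p2).[x]).
      apply: poly_boundedB; last exact: poly_bounded_horner.
      by apply: poly_bounded_sum => b; exact: poly_boundedZ.
    exact: poly_boundedM.
  - by apply: poly_boundedD; exact: poly_boundedZ.
  - move=> x; rewrite big_cons hornerD hornerZ.
    have -> : c a * \1_[set a] x + \sum_(b <- s) c b * \1_[set b] x - (c a * p1.[x] + p2.[x])
      = c a * u x + v x by rewrite /u /v; ring.
    by have := sqr_ge0 (c a * u x - v x); rewrite !expr2; lra.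
rewrite (expD mom); [|exact: poly_boundedZ..].
rewrite !(expZ mom)//.
have : 2 * c a ^+ 2 * E (fun x => u x ^+ 2) <= 2 * c a ^+ 2 * (d / (4 * (c a ^+ 2 + 1))).
  by apply: ler_wpM2l; [rewrite mulr_ge0 ?sqr_ge0|exact: ltW].
have -> : 2 * c a ^+ 2 * (d / (4 * (c a ^+ 2 + 1))) = d / 2 * (c a ^+ 2 / (c a ^+ 2 + 1)).
  by field; rewrite gt_eqF// ltr_wpDl ?sqr_ge0.
have : d / 2 * (c a ^+ 2 / (c a ^+ 2 + 1)) <= d / 2.
  rewrite ler_piMr ?divr_ge0 ?ltW// ltr_pdivrMr ?mul1r ?ltrDl//.
  by rewrite ltr_wpDl ?sqr_ge0.
by move: H2; rewrite -/v; lra.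
Qed.

Lemma sum_indic1 f (s : seq R) x : uniq s ->
  \sum_(a <- s) f a * \1_[set a] x = if x \in s then f x else 0.
Proof.
move=> us; case: ifPn => xs.
  rewrite (bigD1_seq x)//= indicE mem_set// mulr1 big1 ?addr0// => a ax.
  by rewrite indicE memNset ?mulr0// => /= xa; rewrite xa eqxx in ax.
rewrite big1_seq// => a /= as'; rewrite indicE memNset ?mulr0// => /= xa.
by rewrite xa as' in xs.
Qed.

(** As [mu] lives on the range of [z], [f] minus its restriction to the first [M] points tends to 0
    in L2 by dominated convergence, and this restriction is a finite combination of indicators of
    points. *)
Lemma dense_of_atoms (z : nat -> R) : mu (~` range z) = 0%E ->
  (forall k d, 0 < d -> exists p, E (fun x => (\1_[set z k] x - p.[x]) ^+ 2) < d) ->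
  forall f, measurable_fun setT f -> (\int[mu]_x (f x ^+ 2)%:E < +oo)%E ->
  forall d : R, 0 < d -> exists p, (\int[mu]_x ((f x - p.[x]) ^+ 2)%:E < d%:E)%E.
Proof.
move=> z0 zd f mf f2 d d0.
(* [z] may repeat values, and each point must enter the sum once. *)
pose s M := undup (mkseq z M).
pose t M x := \sum_(a <- s M) f a * \1_[set a] x.
have pt M : poly_bounded (t M).
  apply: poly_bounded_sum => a; apply: poly_boundedZ.
  by apply: poly_bounded_indic; exact: measurable_set1.
pose h M x := f x - t M x.
have hE M x : h M x = if x \in mkseq z M then 0 else f x.
  rewrite /h /t sum_indic1 ?undup_uniq// mem_undup.
  by case: ifP; rewrite ?subrr ?subr0.
have mh M : measurable_fun setT (h M) by apply: measurable_funB => //; case: (pt M).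
have mh2 M : measurable_fun setT (fun x => (h M x ^+ 2)%:E).
  by apply/measurable_EFinP; exact: measurable_funX.
have mrange : measurable (range z).
  rewrite (_ : range z = \bigcup_k [set z k]); last first.
    by apply/seteqP; split=> [_ [k _ <-]|_ [k _ ->]]; exists k.
  by apply: bigcup_measurable => k _; exact: measurable_set1.
pose g x := (f x ^+ 2 * \1_(~` range z) x)%:E.
have hg x : setT x -> (fun M => (h M x ^+ 2)%:E) @ \oo --> g x.
  move=> _; apply: cvg_near_cst.
  have [[k _ zk]|xz] := pselect (range z x).
    exists k.+1 => // M /= kM.
    have xm : x \in mkseq z M by apply/mapP; exists k; [rewrite mem_iota add0n|rewrite zk].
    rewrite hE xm /g indicE memNset ?mulr0 ?expr0n//; apply.
    by exists k.
  exists 0%N => // M _; rewrite hE /g indicE mem_set//= mulr1 ifN//.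
  by apply/mapP => -[k _ xk]; apply: xz; exists k.
have if2 : mu.-integrable setT (fun x => (f x ^+ 2)%:E).
  apply/integrableP; split; first by apply/measurable_EFinP; exact: measurable_funX.
  by under eq_integral do rewrite gee0_abs ?lee_fin ?sqr_ge0//.
have ffin x : setT x -> (f x ^+ 2)%:E \is a fin_num by [].
have hf M x : setT x -> (`|(h M x ^+ 2)%:E| <= (f x ^+ 2)%:E)%E.
  move=> _; rewrite gee0_abs ?lee_fin ?sqr_ge0// hE.
  by case: ifP => // _; rewrite expr0n sqr_ge0.
have := @dominated_cvg _ _ _ mu setT measurableT _ _ _ mh2 hg ffin if2 hf.
have -> : (\int[mu]_x g x = 0)%E.
  rewrite -(@null_set_integral _ _ _ mu (~` range z) (fun x => (f x ^+ 2)%:E))//.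
  - rewrite [RHS]integral_mkcond; apply: eq_integral => x _.
    by rewrite /g patchE indicE; case: (_ \in _); rewrite ?mulr1 ?mulr0.
  - exact: measurableC.
  - by apply: measurable_funS measurableT _ _ => //; case/integrableP: if2.
move=> /fine_cvgP[hfin /cvgrPdist_lt/(_ (d / 4))].
rewrite divr_gt0// => /(_ isT) hd.
have [M [Mfin Md]] : exists M, (\int[mu]_x (h M x ^+ 2)%:E)%E \is a fin_num /\
    `|0 - fine (\int[mu]_x (h M x ^+ 2)%:E)%E| < d / 4.
  by have [M _ HM] := filterI hfin hd; exists M; exact: (HM M (leqnn _)).
have hM : (\int[mu]_x (h M x ^+ 2)%:E < (d / 4)%:E)%E.
  rewrite -(fineK Mfin) lte_fin; apply: le_lt_trans Md.
  by rewrite sub0r normrN ler_norm.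
have d4 : 0 < d / 4 by rewrite divr_gt0.
have sz a : a \in s M -> forall d', 0 < d' -> exists p, E (fun x => (\1_[set a] x - p.[x]) ^+ 2) < d'.
  by rewrite mem_undup => /mapP[k _ ->]; exact: zd.
have [p Hp] := approx_atoms f sz d4.
exists p; pose r x := t M x - p.[x].
have pr : poly_bounded r by apply: poly_boundedB => //; exact: poly_bounded_horner.
have pr2 : poly_bounded (fun x => r x ^+ 2) by exact: poly_boundedM.
have mr2 : measurable_fun setT (fun x => (r x ^+ 2)%:E).
  by apply/measurable_EFinP; case: pr2.
have mfp : measurable_fun setT (fun x => ((f x - p.[x]) ^+ 2)%:E).
  apply/measurable_EFinP; apply: measurable_funX; apply: measurable_funB => //.
  by case: (poly_bounded_horner p).
apply: (@le_lt_trans _ _ (\int[mu]_x (2%:E * (h M x ^+ 2)%:E + 2%:E * (r x ^+ 2)%:E))%E).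
  apply: ge0_le_integral => //.
  - by move=> x _; rewrite lee_fin sqr_ge0.
  - by apply: emeasurable_funD; apply: measurable_funeM.
  - move=> x _; rewrite -!EFinM -EFinD lee_fin.
    have -> : f x - p.[x] = h M x + r x by rewrite /h /r; ring.
    by have := sqr_ge0 (h M x - r x); rewrite !expr2; lra.
rewrite ge0_integralD//; last 4 first.
- by move=> x _; rewrite -EFinM lee_fin mulr_ge0// sqr_ge0.
- exact: measurable_funeM.
- by move=> x _; rewrite -EFinM lee_fin mulr_ge0// sqr_ge0.
- exact: measurable_funeM.
rewrite !ge0_integralZl_EFin//; try by move=> x _; rewrite lee_fin sqr_ge0.
rewrite (exp_EFin mom pr2) -(fineK Mfin) -!EFinM -EFinD lte_fin.
move: hM; rewrite -(fineK Mfin) lte_fin => hM.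
by move: Hp; rewrite -/(t M) -/r; lra.
Qed.

End density.

Section basis.
Context {R : realType} {mu : {measure set R -> \bar R}}.
Variable P : nat -> {poly R}.
Hypothesis mom : finite_moments mu.
Hypothesis hP : orthonormal_polys mu P.

Local Notation E f := (\int[mu]_x f x)%R.

Lemma moment_functional_ortho : exists L : {scalar {poly R}},
  (forall p, L p = E (fun x => p.[x])) /\ forall n m, L (P n * P m) = (n == m)%:R.
Proof.
have [_ oP] := orthonormal_polysP mom hP; have [L LE] := moment_functional mom.
exists L; split=> // n m; rewrite LE -oP.
by apply: eq_Rintegral => x _; rewrite hornerM.
Qed.

Lemma basis_of_dense :
  (forall f : R -> R, measurable_fun setT f -> (\int[mu]_x (f x ^+ 2)%:E < +oo)%E ->
   forall d : R, 0 < d -> exists p, (\int[mu]_x ((f x - p.[x]) ^+ 2)%:E < d%:E)%E) ->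
  orthonormal_basis_L2 mu (fun n x => (P n).[x]).
Proof.
have [sP oP] := orthonormal_polysP mom hP; have [L [_ LP]] := moment_functional_ortho.
move=> dense; split; [|split].
- move=> n; have [mPn _] := poly_bounded_horner (P n); split=> //.
  apply/Lnorm2_lty; rewrite (exp_EFin mom) ?ltry//.
  by apply: poly_boundedM; exact: poly_bounded_horner.
- by case: hP.
- move=> f [mf /Lnorm2_lty f2] e e0.
  have [p Hp] := dense f mf f2 (e ^+ 2) (exprn_gt0 2 e0).
  exists (size p), (fun k => L (p * P k)).
  apply/(Lnorm2_lt (fun x => f x - \sum_(k < size p) L (p * P k) * (P k).[x]) e0).
  rewrite (_ : (fun x => _) = (fun x => ((f x - p.[x]) ^+ 2)%:E))//.
  apply/funext => x; congr ((_ - _) ^+ 2)%:E.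
  rewrite [in RHS](orthonormal_expansion sP LP (leqnn (size p))) horner_sum.
  by apply: eq_bigr => k _; rewrite hornerZ.
Qed.

Lemma dense_of_basis : orthonormal_basis_L2 mu (fun n x => (P n).[x]) ->
  forall (A : set R) (d : R), measurable A -> 0 < d ->
    exists p, E (fun x => (\1_A x - p.[x]) ^+ 2) < d.
Proof.
move=> [_ [_ dense]] A d mA d0.
have pI : poly_bounded (\1_A : R -> R) by exact: poly_bounded_indic.
have pI2 : poly_bounded (fun x => \1_A x ^+ 2 : R) by exact: poly_boundedM.
have I2 : inL2 mu (\1_A : R -> R).
  split; first by case: pI.
  by apply/Lnorm2_lty; rewrite (exp_EFin mom) ?ltry.
have s0 : 0 < Num.sqrt d by rewrite sqrtr_gt0.
have [N [c Hc]] := dense _ I2 _ s0.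
exists (\sum_(k < N) c k *: P k).
move/(Lnorm2_lt (fun x => \1_A x - \sum_(k < N) c k * (P k).[x]) s0) : Hc.
rewrite sqr_sqrtr; last exact: ltW.
have pE x : (\sum_(k < N) c k *: P k).[x] = \sum_(k < N) c k * (P k).[x].
  by rewrite horner_sum; apply: eq_bigr => k _; rewrite hornerZ.
under eq_integral do rewrite -pE.
rewrite (exp_EFin mom) ?lte_fin//.
by apply: poly_boundedM; apply: poly_boundedB => //; exact: poly_bounded_horner.
Qed.

(** Let [m] be the mass at [w]. If [p] is within squared distance [m / 4] of the indicator, then
    [p.[w] >= 1 / 2] and [L (p * p) <= 5 / 2 * m], so [p.[w] ^+ 2 <= M * L (p * p)] gives
    [1 / 4 <= 5 / 2 * M * m]. *)
Lemma atom_ge_of_dense (M w : R) : 0 < M ->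
  (forall N, christoffel P N w <= M) ->
  (forall d : R, 0 < d -> exists p, E (fun x => (\1_[set w] x - p.[x]) ^+ 2) < d) ->
  0 < fine (mu [set w]) -> (10 * M)^-1 <= fine (mu [set w]).
Proof.
have [sP oP] := orthonormal_polysP mom hP; have [L [LE LP]] := moment_functional_ortho.
move=> M0 PM dense; set m := fine _ => m0.
have pI : poly_bounded (\1_[set w] : R -> R).
  by apply: poly_bounded_indic; exact: measurable_set1.
have [p Hp] := dense (m / 4) (divr_gt0 m0 (ltr0n _ 4)).
pose r x := \1_[set w] x - p.[x] : R.
have pr : poly_bounded r by apply: poly_boundedB => //; exact: poly_bounded_horner.
have pr2 : poly_bounded (fun x => r x ^+ 2) by exact: poly_boundedM.
have EI : E (\1_[set w]) = m by rewrite exp_indic//; exact: measurable_set1.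
have near1 : (1 - p.[w]) ^+ 2 < 1 / 4.
  have : (1 - p.[w]) ^+ 2 * m <= E (fun x => r x ^+ 2).
    rewrite -EI -(expZ mom)//; apply: (exp_le mom) => // [|x]; first exact: poly_boundedZ.
    rewrite /r !indicE; case: (boolP (x \in [set w])) => [|_].
      by rewrite inE => ->; rewrite mulr1.
    by rewrite mulr0 sqr_ge0.
  move=> /le_lt_trans/(_ Hp); rewrite [m / 4]mulrC ltr_pM2r//.
  by rewrite mul1r.
have Lpp : L (p * p) <= 5 / 2 * m.
  have : L (p * p) <= 2 * E (fun x => r x ^+ 2) + 2 * E (\1_[set w]).
    rewrite LE -!(expZ mom)// -(expD mom); [|exact: poly_boundedZ..].
    apply: (exp_le mom) => [||x].
    - exact: poly_bounded_horner.
    - by apply: poly_boundedD; exact: poly_boundedZ.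
    - rewrite hornerM /r; have : \1_[set w] x * \1_[set w] x = \1_[set w] x :> R.
        by rewrite indicE; case: (_ \in _); rewrite ?mulr1 ?mulr0.
      move: (\1_[set w] x) (p.[x]) => e y ee.
      by have := sqr_ge0 (2 * e - y); rewrite !expr2; lra.
  by rewrite EI; move: Hp; rewrite -/r; lra.
have := sqr_horner_le sP LP w (leqnn (size p)).
have K0 : 0 <= christoffel P (size p) w by apply: sumr_ge0 => k _; rewrite sqr_ge0.
have L0 := orthonormal_sqr_ge0 sP LP p.
move=> /le_trans/(_ (ler_pM K0 L0 (PM _) Lpp)) H.
have p14 : 1 / 4 <= p.[w] ^+ 2.
  have : 1 / 2 <= p.[w].
    by rewrite leNgt; apply/negP => pw; nra.
  by move=> pw; nra.
rewrite invfM ler_pdivrMr//; lra.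
Qed.

End basis.

Section indeterminate.
Context {R : realType} {mu : {measure set R -> \bar R}}.
Variable P : nat -> {poly R}.
Hypothesis mom : finite_moments mu.
Hypothesis hP : orthonormal_polys mu P.

Lemma indeterminate_of_christoffel_bounded : mu [set 0] = 0%E ->
  (forall A, 0 <= A -> exists M, forall N w, `|w| <= A -> christoffel P N w <= M) ->
  ~ determinate mu.
Proof.
move=> mu0 bounded det.
have [sP _] := orthonormal_polysP mom hP; have [L [LE LP]] := moment_functional_ortho mom hP.
(* For [A < 0] no [w] is concerned, and any value of [M] will do. *)
have /choice[M HM] : forall A, exists M, forall N w, `|w| <= A -> christoffel P N w <= M.
  move=> A; have [A0|A0] := leP 0 A; first exact: bounded.
  by exists 0 => N w wA; have := le_lt_trans wA A0; rewrite normr_lt0.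
have [l [y [l0 l00 y0 ly]]] := moments_of_bounded_christoffel sP LP HM.
have [nmom nE] := atomic_measure_moments l0 ly.
have numu k : (\int[atomic_measure y l0]_x ((x ^+ k)%R)%:E = \int[mu]_x ((x ^+ k)%R)%:E)%E.
  rewrite nE LE; under [RHS]eq_integral do rewrite -hornerXn.
  by rewrite (exp_EFin mom (poly_bounded_horner _)).
have := det _ nmom numu _ (measurable_set1 0); rewrite mu0 => nu0.
have := atomic_measure_ge l0 (measurable_set1 0) y0.
by rewrite nu0 lee_fin leNgt l00.
Qed.

End indeterminate.

(** * The measure on the powers of q and the equivalence *)

Section q_measure.
Context {R : realType} (q v : R) (om : R -> R).
Hypotheses (q0 : 0 < q) (q1 : q < 1) (om0 : forall n : int, om (q ^ n) != 0).

Lemma exprz_inj_q : injective (fun n : int => q ^ n).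
Proof. by apply: ieexprIz => //; rewrite lt_eqF. Qed.

Lemma qmass_gt0 n : 0 < qmass q v om n.
Proof.
have qn : 0 < q ^ n by rewrite exprz_gt0.
have om2 : 0 < om (q ^ n) ^+ 2 by rewrite exprn_even_gt0//= om0.
have pw : 0 < `|q ^ n| `^ (2 * v + 1) by rewrite powR_gt0// normr_gt0 gt_eqF.
by rewrite /qmass; do 3! [apply: mulr_gt0 => //]; rewrite subr_gt0.
Qed.

Lemma qmu_atom n : (0 < qmu q v om [set q ^ n])%E.
Proof.
apply: lt_le_trans (dmeasure_atom _ (fun n : int => q ^ n) n).
by rewrite lte_fin normr_gt0 gt_eqF// qmass_gt0.
Qed.

End q_measure.

Theorem theorem1 (R : realType) (q v : R) (om : R -> R)
  (hq0 : 0 < q) (hq1 : q < 1) (hv : -1 < v)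
  (hom_even : forall x : R, om (- x) = om x)
  (hom_nz : forall n : int, om (q ^ n) != 0)
  (hmom : finite_moments (qmu q v om))
  (P : nat -> {poly R})
  (hP : orthonormal_polys (qmu q v om) P) :
  orthonormal_basis_L2 (qmu q v om) (fun n x => (P n).[x]) <->
  determinate (qmu q v om).
Proof.
set mu := qmu q v om in hmom hP *.
have [sP oP] := orthonormal_polysP hmom hP.
have m0 n : 0 < fine (mu [set q ^ n]).
  by rewrite fine_gt0// qmu_atom// ltey_eq fin_num_finite_moments//; exact: measurable_set1.
split=> [/(dense_of_basis hmom) dense|det].
- move=> nu nmom numu.
  have atoms n : nu [set q ^ n] = mu [set q ^ n].
    apply/eqP; apply/negPn/negP => nun.
    have [M0 HM0] := christoffel_bounded_of_moments hmom sP oP nmom numu nun ler01.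
    pose M := Num.max 1 M0; have M_gt0 : 0 < M by rewrite lt_max ltr01.
    (* The atoms [q ^+ k] with [k : nat] all lie in [-1, 1], where the bound [M] holds, and there
       are infinitely many of them. *)
    have big (k : nat) : (10 * M)^-1 <= fine (mu [set q ^+ k]).
      apply: (atom_ge_of_dense hmom hP) => // [N|d d0|].
      - rewrite le_max HM0 ?orbT// ger0_norm.
          by apply: exprn_ile1; exact: ltW.
        by apply: exprn_ge0; exact: ltW.
      - by apply: dense => //; exact: measurable_set1.
      - exact: (m0 k).
    have pI (k : nat) : poly_bounded (\1_[set q ^+ k] : R -> R).
      by apply: poly_bounded_indic; exact: measurable_set1.
    have total K : K%:R * (10 * M)^-1 <= fine (mu setT).
      apply: (@le_trans _ _ (\int[mu]_x (\sum_(k < K) \1_[set q ^+ k] x))%R).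
        elim: K => [|K IH].
          by rewrite mul0r; apply: exp_ge0 => x; rewrite big_ord0.
        under eq_Rintegral do rewrite big_ord_recr /=.
        rewrite (expD hmom)//; last by apply: poly_bounded_sum => k.
        rewrite -natr1 mulrDl mul1r lerD// exp_indic//; exact: measurable_set1.
      rewrite -[leRHS]mul1r -(Rintegral_cst mu measurableT 1).
      apply: (exp_le hmom).
      - by apply: poly_bounded_sum => k.
      - exact: poly_bounded_cst.
      move=> x; have [[k kE]|nx] := pselect (exists k : 'I_K, x = q ^+ k).
        rewrite (bigD1 k)//= indicE mem_set// big1 ?addr0// => j jk.
        rewrite indicE memNset//= kE => /(@exprz_inj_q _ _ hq0 hq1 k j) [kj].
        by rewrite (val_inj kj) eqxx in jk.
      rewrite big1 ?ler01// => k _; rewrite indicE memNset//= => xk.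
      by apply: nx; exists k.
    (* A number of atoms exceeding [mu setT * (10 * M)] contradicts the finiteness of the total
       mass. *)
    have := total (Num.truncn (fine (mu setT) * (10 * M))).+1.
    rewrite ler_pdivrMr ?mulr_gt0// leNgt; apply/negP/negPn.
    exact: truncnS_gt.
  (* The moments of order 0 give equal total masses, and agreement on the atoms gives
     [mu A <= nu A]. *)
  apply: (measure_eq_of_le hmom nmom).
    have := numu 0%N; under eq_integral do rewrite expr0.
    under [X in _ = X -> _]eq_integral do rewrite expr0.
    by rewrite !integral_cst// !mul1e.
  move=> A mA; apply: dmeasure_le => //; exact: exprz_inj_q.
- apply: (basis_of_dense hmom hP).
  (* An enumeration of the atoms by [nat]; codes of no integer fall back on [q ^ 0]. *)
  pose z k : R := q ^ (odflt 0 (unpickle k) : int).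
  have zE n : z (pickle n) = q ^ n by rewrite /z pickleK.
  apply: (dense_of_atoms hmom (z := z)).
    by apply: dmeasure_eq0 => n /= zn; apply: zn; exists (pickle n).
  move=> k d d0; apply: contrapT => nz.
  have far p : d <= \int[mu]_x ((\1_[set z k] x - p.[x]) ^+ 2)%R.
    by rewrite leNgt; apply/negP => pd; apply: nz; exists p.
  have bounded := christoffel_bounded_of_atom hmom sP oP d0 far.
  apply: (indeterminate_of_christoffel_bounded hmom hP _ bounded det).
  by apply: dmeasure_eq0 => n /= /eqP; rewrite expfz_eq0 (gt_eqF hq0) andbF.
Qed.
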